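(* Let $G$ be a finite group and $Z=Z(G)$ its center. If $\Gamma(G)$ is an edgeless graph with two vertices, then $G/Z$ is a solvable Frobenius group.
   Context: For a finite group $G$, $N(G)$ denotes the set of conjugacy class sizes of $G$ excluding $1$. The conjugate graph $\Gamma(G)$ is the directed graph with vertex set $N(G)$ in which, for distinct $a,b\in N(G)$, there is a directed edge from $a$ to $b$ whenever $a$ divides $b$ and $N(G)$ contains no number $c$ different from $a$ and $b$ such that $a$ divides $c$ and $c$ divides $b$. *)

(* Defs.v *)
From mathcomp Require Import all_boot all_fingroup all_solvable.

Set Implicit Arguments.
Unset Strict Implicit.
Unset Printing Implicit Defensive.

Definition class_sizes (gT : finGroupType) (G : {group gT}) : seq nat :=
  [seq n <- undup [seq #|xG| | xG : {set gT} in classes G] | n != 1].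

Definition conj_vertex (gT : finGroupType) (G : {group gT}) : finType :=
  seq_sub (class_sizes G).

Definition conj_graph (gT : finGroupType) (G : {group gT}) :
    rel (conj_vertex G) :=
  fun a b =>
    [&& a != b, val a %| val b
      & ~~ [exists c : conj_vertex G,
              [&& c != a, c != b, val a %| val c & val c %| val b]]].

Definition edgeless (V : finType) (e : rel V) : Prop :=
  forall x y : V, ~~ e x y.

(* Main.v *)
(* Let Z be the centre of G and write X = G / Z.  The hypothesis says that the
   centralisers of noncentral elements have two orders, neither dividing the other.
   Hence C_G(x) <= C_G(y) forces equality, and C_G(x) is abelian or C_G(x) / Z is a
   p-group.  Call C_G(x) tame when some prime dividing its order modulo Z has an
   abelian Sylow subgroup in G; tame centralisers of equal order are abelian and
   conjugate.

   If both orders are tame, X is partitioned by the conjugates of two abelian TI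
   subgroups, and counting shows that one of them is a Frobenius complement, with
   nilpotent kernel.

   An untame C_G(x) is an r-group modulo Z, with R a nonabelian Sylow r-subgroup of
   G.  Then X is solvable: if both orders are untame, #|X| has two prime divisors,
   and otherwise the tame centralisers have index a power of r in X.  In the solvable
   group X no nontrivial r-element commutes with a nontrivial r'-element, so that
   X = (R / Z) ><| H is a Frobenius group once R / Z is normal.  If it is not, an
   element e of order r acts with nontrivial norm on an abelian normal r-subgroup M,
   and lifting commutation from X to G leaves only the case r = 2, #|M| = 4, where
   an element of order 4 contradicts the orders of the centralisers. *)

Require Import Defs.
From mathcomp Require Import all_boot all_fingroup all_solvable.
From mathcomp Require Import ssralg all_character.

Set Implicit Arguments.
Unset Strict Implicit.
Unset Printing Implicit Defensive.

Import GRing.Theory FiniteModule.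

Local Open Scope group_scope.

(** * Norm identities *)

(** Commutation in [G / 'Z(G)] lifts to [G] for elements of coprime orders, but not for two
    [r]-elements; this is why the last steps, inside a normal [r]-subgroup, need other arguments.
    The substitute is the norm. If [x] has prime order [p] modulo an abelian subgroup [D] that it
    normalises, the norms of [D] under [x] are read off from the powers [(d * x) ^+ p]. By the
    antichain condition, such a power is central or has the same centraliser as [d * x]. In the
    first case averaging identities restrict the group acting on [D]; in the second one nontrivial
    norm forces further commutation. *)

Section NormIdentity.

Variables (eT gT : finGroupType) (E : {group eT}) (D Z0 : {group gT}).
Hypothesis abD : abelian D.
Variable rho : eT -> fmod_of abD -> fmod_of abD.
Hypothesis rhoM : {in E &, forall x y u, rho (x * y) u = rho y (rho x u)}.
Hypothesis rho1 : forall u, rho 1 u = u.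

(* Additively, [\sum_i rho (y ^+ i) u] is the norm of [u] under [<[y]>].  Summing
   the norms under all [c h] expresses [#|H|] times [u] by norms, because for
   [0 < i < p] the elements [c h ^+ i] run over the coset [e ^+ i * H].  This is
   used for [c h = e ^ h] (a Frobenius group [H ><| <[e]>]) and for
   [c h = e * h] (an elementary abelian group of order [p ^ 2]). *)
Lemma norm_expansion (H : {group eT}) (e : eT) (c : eT -> eT)
    (phi : nat -> eT -> eT) (p : nat) (u : fmod_of abD) :
    H \subset E -> e \in E -> 0 < p ->
    (forall i h, 0 < i < p -> h \in H -> c h ^+ i = e ^+ i * phi i h) ->
    (forall i h, 0 < i < p -> h \in H -> phi i h \in H) ->
    (forall i, 0 < i < p -> {in H &, injective (phi i)}) ->
  (\sum_(h in H) \sum_(0 <= i < p) rho (c h ^+ i) u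
    = u *+ #|H| + \sum_(1 <= i < p) \sum_(h in H) rho h (rho (e ^+ i) u))%R.
Proof.
move=> sHE Ee p_gt0 Dc Hphi injphi; rewrite exchange_big /= big_ltn //.
congr (_ + _)%R.
  by rewrite -sumr_const; apply: eq_bigr => h _; rewrite expg0 rho1.
apply: eq_big_nat => i ip.
have permH : [set phi i h | h in H] = H.
  apply/eqP; rewrite eqEcard card_in_imset ?leqnn ?andbT; last exact: injphi.
  by apply/subsetP=> _ /imsetP[h Hh ->]; apply: Hphi.
rewrite -[in RHS]permH big_imset /=; last exact: injphi.
apply: eq_bigr => h Hh; rewrite Dc // rhoM ?groupX //.
by rewrite (subsetP sHE) ?Hphi.
Qed.

Lemma sum_cycle (T : nmodType) (f : eT) (F : eT -> T) :
  (\sum_(h in <[f]>) F h = \sum_(0 <= i < #[f]) F (f ^+ i)%g)%R.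
Proof.
have eq_f: <[f]> = [set f ^+ i | i : 'I_#[f]].
  apply/setP=> x; apply/cycleP/imsetP=> [[i ->]|[i _ ->]]; last by exists i.
  by exists (Ordinal (ltn_pmod i (order_gt0 f))); rewrite ?expg_mod_order.
rewrite big_mkord (eq_bigl [in [set f ^+ i | i : 'I_#[f]]]); last first.
  by move=> h; rewrite -eq_f.
rewrite big_imset //= => i j _ _ /eqP.
by rewrite eq_expg_mod_order !modn_small // => /eqP/val_inj.
Qed.

Let inZ (u : fmod_of abD) := fmval u \in Z0.

Let inZsum (I : finType) (P : pred I) (F : I -> fmod_of abD) :
  (forall i, P i -> inZ (F i)) -> inZ (\sum_(i | P i) F i)%R.
Proof.
move=> ZF; apply: (big_ind inZ) => //; first by rewrite /inZ fmval0 group1.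
by move=> u v; rewrite /inZ fmvalA; apply: groupM.
Qed.

Let inZsum_nat m n (F : nat -> fmod_of abD) :
  (forall i, m <= i < n -> inZ (F i)) -> inZ (\sum_(m <= i < n) F i)%R.
Proof.
move=> ZF; rewrite big_nat; apply: (big_ind inZ) => //.
  by rewrite /inZ fmval0 group1.
by move=> u v; rewrite /inZ fmvalA; apply: groupM.
Qed.

(** [Z0] stays a parameter: it is trivial for conjugation on [M], and ['Z(G)] for [N / D] acting on
    [D]. *)
Lemma norm_expansion_sub (H : {group eT}) (e : eT) (c : eT -> eT)
    (phi : nat -> eT -> eT) (p : nat) (u : fmod_of abD) :
    H \subset E -> e \in E -> 0 < p ->
    (forall i h, 0 < i < p -> h \in H -> c h ^+ i = e ^+ i * phi i h) ->
    (forall i h, 0 < i < p -> h \in H -> phi i h \in H) ->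
    (forall i, 0 < i < p -> {in H &, injective (phi i)}) ->
    (forall h, h \in H ->
       fmval (\sum_(0 <= i < p) rho (c h ^+ i) u)%R \in Z0) ->
    (forall v, fmval (\sum_(h in H) rho h v)%R \in Z0) ->
  fmval u ^+ #|H| \in Z0.
Proof.
move=> sHE Ee p_gt0 Dc Hphi injphi Zc ZH.
have := norm_expansion u sHE Ee p_gt0 Dc Hphi injphi.
move/(congr1 (@fmval _ _ abD)); rewrite fmvalA fmvalZ => Dsum.
rewrite -(mulgK (fmval (\sum_(1 <= i < p) \sum_(h in H) rho h (rho (e ^+ i) u))%R)
             (_ ^+ _)) -Dsum.
rewrite groupM //; first by apply: inZsum => h /Zc.
by rewrite groupV; apply: inZsum_nat => i _; apply: ZH.
Qed.

Lemma Frobenius_norm_sub (H : {group eT}) (e : eT) (u : fmod_of abD) :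
    H \subset E -> e \in E -> e \in 'N(H) -> prime #[e] -> 'C_H[e] = 1 ->
    (forall x v, x \in E -> #[x] = #[e] ->
       fmval (\sum_(0 <= i < #[x]) rho (x ^+ i) v)%R \in Z0) ->
    (forall v, fmval (\sum_(h in H) rho h v)%R \in Z0) ->
  fmval u ^+ #|H| \in Z0.
Proof.
move=> sHE Ee nHe pr_e regHe Ze ZH.
have ZeJ h : h \in H ->
    fmval (\sum_(0 <= i < #[e]) rho ((e ^ h) ^+ i) u)%R \in Z0.
  move=> Hh; have := Ze (e ^ h) u; rewrite orderJ; apply=> //.
  by rewrite groupJ // (subsetP sHE).
apply: (norm_expansion_sub sHE Ee (prime_gt0 pr_e) (c := fun h => e ^ h)
         (phi := fun i h => [~ e ^+ i, h])) => //.
- by move=> i h _ Hh; rewrite -conjXg conjg_mulR.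
- by move=> i h _ Hh; rewrite commgEr groupM // -?mem_conjg ?(normP _) ?groupV
    ?memJ_norm ?groupV // ?groupX.
(* Equal commutators put [h1 * h2^-1] in the centraliser of [e ^+ i], which generates [<[e]>]
   because [#[e]] is prime. *)
move=> i /andP[i_gt0 i_lt] h1 h2 Hh1 Hh2 /= eq12.
apply/eqP; rewrite eq_mulgV1 -in_set1 -[[set 1]]regHe inE groupM ?groupV //=.
have eqJ: (e ^+ i) ^ h1 = (e ^+ i) ^ h2 by rewrite !conjg_mulR eq12.
have cei: h1 * h2^-1 \in 'C[e ^+ i].
  by apply/cent1P/commute_sym/commgP/conjg_fixP; rewrite conjgM eqJ conjgK.
rewrite -cent_cycle; suff -> : <[e]> = <[e ^+ i]> by rewrite cent_cycle.
apply/eqP; rewrite -[_ == _]/(generator <[e]> (e ^+ i)) generator_coprime.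
by rewrite prime_coprime // gtnNdvd.
Qed.

(** The groups [<[e * h]>], for [h] in [<[f]>], and [<[f]>] itself are the [p + 1] subgroups of
    order [p = #[e]] of the plane. *)
Lemma plane_norm_sub (e f : eT) (u : fmod_of abD) :
    e \in E -> f \in E -> commute e f -> prime #[e] -> #[f] = #[e] ->
    e \notin <[f]> ->
    (forall x v, x \in E -> #[x] = #[e] ->
       fmval (\sum_(0 <= i < #[x]) rho (x ^+ i) v)%R \in Z0) ->
  fmval u ^+ #[e] \in Z0.
Proof.
move=> Ee Ef cef pr_e of_ nfe Ze.
have cfh h : h \in <[f]> -> commute e h.
  by case/cycleP=> i ->; apply: commuteX.
have pr_f : prime #[f] by rewrite of_.
rewrite -of_; apply: (norm_expansion_sub (H := [group of <[f]>])
   (e := e) (p := #[e]) (c := fun h => e * h)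
   (phi := fun i h => h ^+ i)) => //.
- by rewrite cycle_subG.
- by move=> i h _ /cfh cfeh; rewrite expgMn.
- by move=> i h _ fh; rewrite groupX.
- move=> i /andP[i_gt0 i_lt] h1 h2 fh1 fh2 /= eq12.
  have co : coprime #|<[f]>| i.
    by rewrite -orderE of_ prime_coprime // gtnNdvd.
  by rewrite -(expgK co fh1) /= eq12; apply: expgK.
- move=> h fh; have oeh : #[e * h] = #[e].
    apply: nt_prime_order => //.
      rewrite expgMn; last exact: cfh.
      rewrite expg_order mul1g; apply/eqP; rewrite -order_dvdn -of_.
      exact: order_dvdG.
    by apply: contra nfe => /eqP/(canRL (mulgK h))->; rewrite mul1g groupV.
  rewrite -oeh; apply: (Ze _ _ _ oeh).
  by rewrite groupM // (subsetP _ _ fh) // cycle_subG.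
move=> v; have := Ze f v Ef of_; by rewrite sum_cycle.
Qed.

End NormIdentity.

(** Turns norms into powers: when [x ^+ k = 1], the norm of [u] is a [k]-th power of an element of
    the coset [D * x^-1]. *)
Lemma fmval_norm (gT : finGroupType) (D : {group gT}) (abD : abelian D)
    (u : fmod_of abD) (x : gT) k : x \in 'N(D) ->
  fmval (\sum_(0 <= i < k) u ^@ (x ^+ i))%R = (fmval u * x^-1) ^+ k * x ^+ k.
Proof.
move=> nDx; elim: k => [|k IHk]; first by rewrite big_nil fmval0 mulg1.
rewrite big_nat_recr //= [LHS]fmvalA [X in X * _]IHk [X in _ * X]fmvalJ ?groupX // expgSr.
by rewrite conjgE -!mulgA mulKVg expgS mulKg.
Qed.

Section ConjNorm.

Variables (gT : finGroupType) (M E : {group gT}).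
Hypotheses (abM : abelian M) (nME : E \subset 'N(M)).

Let rho (x : gT) (u : fmod_of abM) := (u ^@ x)%R.

Let rhoM : {in E &, forall x y u, rho (x * y) u = rho y (rho x u)}.
Proof. by move=> x y Ex Ey u; rewrite /rho actrM // (subsetP nME). Qed.

Let rho1 u : rho 1 u = u. Proof. exact: actr1. Qed.

(** A norm under [x] is fixed by [x]; without fixed points all norms vanish, and [plane_norm_sub]
    gives [m ^+ #[e] = 1] on [M], against coprimality. *)
Lemma plane_fixpoint (e f : gT) :
    e \in E -> f \in E -> commute e f -> prime #[e] -> #[f] = #[e] ->
    e \notin <[f]> -> M :!=: 1 -> coprime #|M| #[e] ->
  exists2 x, x \in E /\ #[x] = #[e] & 'C_M[x] != 1.
Proof.
move=> Ee Ef cef pr_e of_ nfe ntM coMe.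
have [/exists_inP[x Ex /andP[/eqP ox ntC]]|/exists_inPn no_x] :=
  boolP [exists x in E, (#[x] == #[e]) && ('C_M[x] != 1)]; first by exists x.
case/eqP: ntM; apply/trivgP/subsetP=> m Mm; rewrite inE.
have Zx x v : x \in E -> #[x] = #[e] ->
  fmval (\sum_(0 <= i < #[x]) rho (x ^+ i) v)%R \in [1 gT].
- move=> Ex ox; have := no_x x Ex; rewrite ox eqxx negbK => /eqP <-.
  rewrite inE fmodP /=.
  have My: fmval (\sum_(0 <= i < #[e]) rho (x ^+ i) v)%R \in M by apply: fmodP.
  move: My; rewrite fmval_norm ?(subsetP nME) // -ox expg_order mulg1 => My.
  (* The norm commutes with [v], and with [v * x^-1] of which it is a power, hence with [x]. *)
  apply/cent1P; have cyM: commute ((fmval v * x^-1) ^+ #[x]) (fmval v).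
    by apply: (centsP abM) => //; apply: fmodP.
  have: commute ((fmval v * x^-1) ^+ #[x]) (fmval v * x^-1).
    exact/commute_sym/commuteX.
  move/(commuteM (commuteV cyM)); rewrite mulKg.
  by move/commuteV; rewrite invgK.
have := plane_norm_sub rhoM rho1 (fmod abM m) Ee Ef cef pr_e of_ nfe Zx.
rewrite fmodK // inE -order_dvdn => oM_e.
rewrite -order_eq1 -dvdn1 -(eqP coMe) dvdn_gcd oM_e andbT.
exact: order_dvdG.
Qed.

(** Norms under [H] vanish since ['C_M(H) = 1]; if those under elements of order [#[e]] did too,
    [Frobenius_norm_sub] would give [m ^+ #|H| = 1] on [M]. *)
Lemma Frobenius_norm_neq1 (H : {group gT}) (e : gT) :
    H \subset E -> e \in E -> e \in 'N(H) -> prime #[e] -> 'C_H[e] = 1 ->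
    'C_M(H) = 1 -> M :!=: 1 -> coprime #|M| #|H| ->
  exists x, exists2 m, [/\ x \in E, #[x] = #[e] & m \in M]
                       & (m * x) ^+ #[e] != 1.
Proof.
move=> sHE Ee nHe pr_e regHe regMH ntM coMH.
have [/exists_inP[x Ex /andP[/eqP ox /exists_inP[m Mm nt]]]|/exists_inPn no_x] :=
  boolP [exists x in E, (#[x] == #[e]) &&
            [exists m in M, (m * x) ^+ #[e] != 1]]; first by exists x, m.
case/eqP: ntM; apply/trivgP/subsetP=> m Mm; rewrite inE.
have Zx x v : x \in E -> #[x] = #[e] ->
  fmval (\sum_(0 <= i < #[x]) rho (x ^+ i) v)%R \in [1 gT].
- move=> Ex ox; rewrite fmval_norm ?(subsetP nME) // expg_order mulg1 inE.
  have := no_x x^-1; rewrite groupV orderV ox eqxx => /(_ Ex)/exists_inPn.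
  by move/(_ _ (fmodP v)); rewrite negbK.
have ZH v : fmval (\sum_(h in H) rho h v)%R \in [1 gT].
  rewrite -regMH inE fmodP /=.
  apply/centP=> h Hh; apply/commgP/conjg_fixP.
  rewrite -fmvalJ ?(subsetP nME) ?(subsetP sHE) //; congr (fmval _).
  rewrite /rho actr_sum; rewrite [RHS](reindex_acts 'R _ Hh) ?astabsR //=.
  by apply: eq_bigr => k Hk; rewrite actrM // ?(subsetP nME) ?(subsetP sHE).
have := Frobenius_norm_sub rhoM rho1 (fmod abM m) sHE Ee nHe pr_e regHe Zx ZH.
rewrite fmodK // inE -order_dvdn => oM_e.
rewrite -order_eq1 -dvdn1 -(eqP coMH) dvdn_gcd oM_e andbT.
exact: order_dvdG.
Qed.

End ConjNorm.

Section QuotientNorm.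

Variables (gT : finGroupType) (D Z0 N : {group gT}).
Hypothesis abD : abelian D.
Hypothesis norm_sub : forall x d p, x \in N :\: D -> prime p ->
  x ^+ p \in D -> d \in D -> (d * x) ^+ p \in Z0.

Let actr_coset (u : fmod_of abD) x y : x \in 'N(D) -> y \in 'N(D) ->
  coset D x = coset D y -> (u ^@ x = u ^@ y)%R.
Proof.
move=> nx ny /(rcoset_kercosetP nx ny)/rcosetP[d Dd ->].
have nDd := subsetP (normG D) _ Dd.
rewrite actrM //; apply: (congr1 (actr^~ y)).
apply: fmod_inj; rewrite fmvalJ ?(subsetP (normG D)) //.
by apply/conjg_fixP/commgP; apply: (centsP abD); rewrite ?fmodP.
Qed.

Let rho (v : coset_of D) (u : fmod_of abD) := (u ^@ repr v)%R.

Let repr_N (v : coset_of D) : repr v \in 'N(D).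
Proof. exact: repr_coset_norm. Qed.

Let rhoM : {in N / D &, forall x y u, rho (x * y) u = rho y (rho x u)}.
Proof.
move=> x y _ _ u; rewrite /rho -actrM //; apply: actr_coset; rewrite ?groupM //.
by rewrite coset_reprK [RHS]morphM //= !coset_reprK.
Qed.

Let rho1 u : rho 1 u = u.
Proof.
rewrite -[RHS]actr1; apply: actr_coset; rewrite ?group1 //.
by rewrite coset_reprK morph1.
Qed.

Let rho_norm v u : v \in N / D -> prime #[v] ->
  fmval (\sum_(0 <= i < #[v]) rho (v ^+ i) u)%R \in Z0.
Proof.
case/morphimP=> y nDy Ny Dv pr_v; set p := #[v] in pr_v *.
have ntDy : y \in N :\: D.
  rewrite inE Ny andbT; apply: contraTN pr_v => /coset_id Dy1.
  by rewrite /p Dv /= Dy1 order1.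
have Dyp : y ^+ p \in D.
  by apply: coset_idr; rewrite ?groupX // morphX //= -[coset D y]Dv expg_order.
rewrite (eq_bigr (fun i => actr u (y ^+ i))) => [|i _]; last first.
  apply: actr_coset; rewrite ?groupX //.
  by rewrite coset_reprK Dv [RHS]morphX.
(* The norm is [(u * y^-1) ^+ p * y ^+ p]; [norm_sub] applies to [y^-1] and to [y]. *)
rewrite fmval_norm // groupM //.
  apply: norm_sub (fmodP u) => //; last by rewrite expgVn groupV.
  by rewrite inE !groupV -in_setD.
by rewrite -[y]mul1g norm_sub ?group1.
Qed.

Lemma quotient_plane_norm (v w : coset_of D) d :
    v \in N / D -> w \in N / D -> commute v w -> prime #[v] -> #[w] = #[v] ->
    v \notin <[w]> -> d \in D ->
  d ^+ #[v] \in Z0.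
Proof.
move=> Vv Vw cvw pr_v ow nvw Dd.
have Zx x u : x \in N / D -> #[x] = #[v] ->
    fmval (\sum_(0 <= i < #[x]) rho (x ^+ i) u)%R \in Z0.
  by move=> Vx ox; rewrite rho_norm // ox.
have := plane_norm_sub rhoM rho1 (fmod abD d) Vv Vw cvw pr_v ow nvw Zx.
by rewrite fmodK.
Qed.

Lemma quotient_Frobenius_norm (h v : coset_of D) d :
    h \in N / D -> v \in N / D -> v \in 'N(<[h]>) -> prime #[h] -> prime #[v] ->
    'C_(<[h]>)[v] = 1 -> d \in D ->
  d ^+ #[h] \in Z0.
Proof.
move=> Vh Vv nhv pr_h pr_v regHv Dd.
have Zx x u : x \in N / D -> #[x] = #[v] ->
    fmval (\sum_(0 <= i < #[x]) rho (x ^+ i) u)%R \in Z0.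
  by move=> Vx ox; rewrite rho_norm // ox.
have ZH u : fmval (\sum_(g in <[h]>) rho g u)%R \in Z0.
  by rewrite sum_cycle rho_norm.
have shV : <[h]> \subset N / D by rewrite cycle_subG.
have := Frobenius_norm_sub rhoM rho1 (fmod abD d) shV Vv nhv pr_v regHv Zx ZH.
by rewrite fmodK.
Qed.

End QuotientNorm.

Lemma pgroup_elt (gT : finGroupType) (pi : nat_pred) (H : {group gT}) :
  {in H, forall x, pi.-elt x} -> pi.-group H.
Proof.
move=> piH; apply/pgroupP=> q pr_q /Cauchy[//|x Hx ox].
by have := piH x Hx; rewrite /p_elt ox pnatE.
Qed.

Lemma not_pgroup_prime (gT : finGroupType) (p : nat) (H : {group gT}) :
  ~~ p.-group H -> exists2 q, prime q & q != p /\ q %| #|H|.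
Proof.
move=> npH; have [/hasP[q + neq_qp]|/hasPn all_p] :=
  boolP (has [pred q | q != p] (primes #|H|)).
  by rewrite mem_primes => /and3P[pr_q _ q_dv]; exists q.
case/negP: npH; apply/pgroupP=> q pr_q q_dv; apply/negPn.
by apply: all_p; rewrite mem_primes pr_q cardG_gt0.
Qed.

Lemma quotient_lift_elt (gT : finGroupType) (pi : nat_pred) (H Z : {group gT}) y :
  y \in H / Z -> pi.-elt y ->
  exists2 x, x \in H /\ pi.-elt x & x \in 'N(Z) /\ y = coset Z x.
Proof.
case/morphimP=> x nZx Hx -> /= pi_y; exists x.`_pi.
  by rewrite groupX ?p_elt_constt.
by rewrite groupX //= [RHS](morph_constt (coset_morphism Z)) // constt_p_elt.
Qed.

Lemma pelt_uniq (gT : finGroupType) (y : gT) (p q : nat) :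
  y != 1 -> p.-elt y -> q.-elt y -> p = q.
Proof.
move=> nty py qy; have pr_d : prime (pdiv #[y]) by rewrite pdiv_prime // order_gt1.
have := pnat_dvd (pdiv_dvd _) py; have := pnat_dvd (pdiv_dvd _) qy.
by rewrite !pnatE // => /eqnP <- /eqnP.
Qed.

(** * Centralisers when their orders form an antichain *)

Definition cent_antichain (gT : finGroupType) (G : {group gT}) :=
  {in G :\: 'Z(G) &, forall x y,
     #|'C_G[x]| %| #|'C_G[y]| -> #|'C_G[x]| = #|'C_G[y]|}.

Section Centralisers.

Variables (gT : finGroupType) (G : {group gT}).
Hypothesis anti : cent_antichain G.

Local Notation Z := 'Z(G).
Local Notation nc x := (x \in G :\: 'Z(G)).

Lemma cent1XS x k : 'C_G[x] \subset 'C_G[x ^+ k].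
Proof.
rewrite setIS //; apply/subsetP=> y /cent1P cyx.
exact/cent1P/commuteX.
Qed.

Lemma nc_G x : nc x -> x \in G. Proof. by case/setDP. Qed.

Lemma center_sub_cent1 x : x \in G -> Z \subset 'C_G[x].
Proof.
move=> Gx; apply/subsetP=> z /setIP[Gz cGz]; rewrite inE Gz.
by apply/cent1P; apply: (centP cGz).
Qed.

Lemma cent1_id x : x \in G -> x \in 'C_G[x].
Proof. by move=> Gx; rewrite inE Gx cent1id. Qed.

Lemma cent1_sym x y : x \in G -> y \in 'C_G[x] -> x \in 'C_G[y].
Proof. by move=> Gx /setIP[_ cxy]; rewrite inE Gx cent1C. Qed.

Lemma cent1_sub_eq x y : nc x -> nc y -> 'C_G[x] \subset 'C_G[y] ->
  'C_G[x] = 'C_G[y].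
Proof.
move=> ncx ncy sxy; apply/eqP; rewrite eqEcard sxy.
by rewrite -(anti ncx ncy) ?leqnn ?cardSg.
Qed.

Lemma cent1_expg_eq x k : nc x -> nc (x ^+ k) -> 'C_G[x] = 'C_G[x ^+ k].
Proof. by move=> ncx ncxk; apply: cent1_sub_eq => //; apply: cent1XS. Qed.

Lemma cent1_abelian_eq x y : nc x -> nc y -> y \in 'C_G[x] ->
  abelian 'C_G[x] -> 'C_G[x] = 'C_G[y].
Proof.
move=> ncx ncy Cy abC; apply: cent1_sub_eq => //.
by rewrite subsetI subsetIl sub_cent1 (subsetP abC).
Qed.

(** Both [x] and [y] are powers of [x * y], and the noncentral power [x] has the same centraliser as
    [x * y]. *)
Lemma cent1_pi_sub pi x y : nc x -> pi.-elt x -> y \in 'C_G[x] ->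
  pi^'.-elt y -> 'C_G[x] \subset 'C_G[y].
Proof.
move=> ncx pix Cy pi'y; have Gx := nc_G ncx; have [Gy /cent1P cyx] := setIP Cy.
have Dx : (x * y).`_pi = x.
  rewrite consttM; last exact/commute_sym.
  by rewrite constt_p_elt // (constt1P pi'y) mulg1.
have Dy : (x * y).`_pi^' = y.
  rewrite consttM; last exact/commute_sym.
  rewrite (constt_p_elt pi'y) (constt1P _) ?mul1g //.
  by rewrite p_eltNK.
have ncxy : nc (x * y).
  rewrite in_setD (groupM Gx Gy) andbT; case/setDP: ncx => _; apply: contra => Zxy.
  by rewrite -Dx groupX.
have -> : 'C_G[x] = 'C_G[x * y].
  by rewrite -{1}Dx -cent1_expg_eq // -/(_.`_pi) Dx.
by rewrite -{2}Dy; apply: cent1XS.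
Qed.

(** For [v] in the common centraliser, [cent1_pi_sub] from [x] handles the [pi']-part of [v], and
    from [y] its [pi]-part. *)
Lemma cent1_coprime pi x y : nc x -> nc y -> pi.-elt x -> pi^'.-elt y ->
  y \in 'C_G[x] -> 'C_G[x] = 'C_G[y] /\ abelian 'C_G[x].
Proof.
move=> ncx ncy pix pi'y Cy.
have Cxy : 'C_G[x] = 'C_G[y].
  by apply: cent1_sub_eq => //; apply: cent1_pi_sub pix Cy pi'y.
split=> //; apply/centsP=> v Cv; apply/centP.
suff: 'C_G[x] \subset 'C_G[v] by rewrite subsetI sub_cent1 => /andP[].
have Cvp q : v.`_q \in 'C_G[x] by rewrite groupX.
have s1 : 'C_G[x] \subset 'C_G[v.`_pi^'].
  by apply: cent1_pi_sub pix _ _ => //; apply: p_elt_constt.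
have s2 : 'C_G[x] \subset 'C_G[v.`_pi].
  rewrite Cxy; apply: cent1_pi_sub pi'y _ _ => //; first by rewrite -Cxy.
  by rewrite p_eltNK p_elt_constt.
rewrite subsetI subsetIl sub_cent1 /= -(consttC pi v) groupM //.
  by rewrite -sub_cent1; move: s2; rewrite subsetI => /andP[].
by rewrite -sub_cent1; move: s1; rewrite subsetI => /andP[].
Qed.

(** Some [p]-part [y] of [x] is noncentral and has the same centraliser. A noncentral [p']-element
    in it makes it abelian; without one it is a [p]-group modulo [Z]. *)
Lemma cent1_dichotomy x : nc x ->
  abelian 'C_G[x] \/ exists2 p, prime p & p.-group ('C_G[x] / Z).
Proof.
move=> ncx; have Gx := nc_G ncx.
have [p pr_p ncxp] : exists2 p, prime p & nc x.`_p.
  have [/exists_inP[p _ /andP[pr_p ncp]]|/exists_inPn no_p] :=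
     boolP [exists p in 'I_(#[x].+1), prime p && nc x.`_p]; first by exists p.
  (* [x] is the product of its [p]-parts over all [p <= #[x]]; those at nonprime [p] are [1]. *)
  case/setDP: ncx => _ /negP[]; rewrite -[x]prod_constt big_mkord.
  apply: group_prod => p _; have := no_p p isT.
  have [pr_p | npr_p _] := boolP (prime p).
    by rewrite in_setD (groupX _ Gx) andbT negbK.
  rewrite (constt1P _) ?group1 //; apply/pnatP=> // q pr_q _.
  by apply: contra npr_p => /eqnP <-.
rewrite (cent1_expg_eq ncx ncxp) -/(x.`_p); set y := x.`_p in ncxp *.
have py : p.-elt y by apply: p_elt_constt.
have [/exists_inP[w Cw /andP[ncw p'w]]|/exists_inPn no_w] :=
  boolP [exists w in 'C_G[y], (nc w) && p^'.-elt w].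
  by left; case: (cent1_coprime ncxp ncw py p'w Cw).
right; exists p => //; apply: pgroup_elt => _ /morphimP[w nZw Cw ->] /=.
rewrite -(consttC p w) morphM ?groupX //= (coset_id (_ : w.`_p^' \in Z)).
  by rewrite mulg1 morph_p_elt ?groupX ?p_elt_constt.
have := no_w w.`_p^' _; rewrite groupX // p_elt_constt andbT in_setD => /(_ isT).
by case/setIP: Cw => Gw _; rewrite (groupX _ Gw) andbT negbK.
Qed.

Lemma coset_center_neq1 x : nc x -> coset Z x != 1.
Proof.
case/setDP=> Gx; apply: contra => /eqP/coset_idr; apply.
by rewrite (subsetP (normal_norm (center_normal G))).
Qed.

Lemma cent1_quo_p x p : nc x -> p.-group ('C_G[x] / Z) -> p.-elt (coset Z x).
Proof.
move=> ncx /mem_p_elt; apply; apply: mem_quotient.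
exact/cent1_id/nc_G.
Qed.

Lemma card_cent1_quo x : x \in G -> #|'C_G[x]| = (#|Z| * #|'C_G[x] / Z|)%N.
Proof.
move=> Gx; rewrite card_quotient ?Lagrange ?center_sub_cent1 //.
by rewrite (subset_trans (subsetIl _ _)) ?normal_norm ?center_normal.
Qed.

Lemma cent1_pgroup_card_eq x y (p : nat) : nc x -> nc y ->
  p.-group ('C_G[x] / Z) -> p.-group ('C_G[y] / Z) -> #|'C_G[x]| = #|'C_G[y]|.
Proof.
wlog le_xy : x y / logn p #|'C_G[x] / Z| <= logn p #|'C_G[y] / Z|.
  move=> IH; case/orP: (leq_total (logn p #|'C_G[x] / Z|) (logn p #|'C_G[y] / Z|)).
    exact: IH.
  by move=> le ncx ncy px py; apply/esym/IH.
move=> ncx ncy px py; have [Gx Gy] := (nc_G ncx, nc_G ncy).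
apply: anti => //; rewrite !card_cent1_quo // dvdn_pmul2l ?cardG_gt0 //.
by rewrite (card_pgroup px) (card_pgroup py) dvdn_exp2l.
Qed.

End Centralisers.

Lemma pgroup_dvd (gT : finGroupType) (p : nat) (P : {group gT}) :
  p.-group P -> P :!=: 1 -> p %| #|P|.
Proof. by move=> pP ntP; have [] := pgroup_pdiv pP ntP. Qed.

Lemma expg_coprime_mem (gT : finGroupType) (H : {group gT}) x k :
  coprime #[x] k -> x ^+ k \in H -> x \in H.
Proof.
move=> co_xk; rewrite -!cycle_subG; suff -> : <[x ^+ k]> = <[x]> by [].
by apply/esym/eqP; rewrite -[_ == _]/(generator <[x]> (x ^+ k)) generator_coprime.
Qed.

Lemma mem_pcore_abelian (gT : finGroupType) pi (D : {group gT}) x :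
  abelian D -> x \in D -> pi.-elt x -> x \in 'O_pi(D).
Proof.
move=> abD Dx pix.
by rewrite (mem_normal_Hall (nilpotent_pcore_Hall _ (abelian_nil abD))) ?pcore_normal.
Qed.

(** * Abelian centralisers and the quotients of their normalisers *)

Section Components.

Variables (gT : finGroupType) (G : {group gT}).
Hypothesis anti : cent_antichain G.

Local Notation Z := 'Z(G).
Local Notation nc x := (x \in G :\: 'Z(G)).

Let nZG : G \subset 'N(Z). Proof. exact/normal_norm/center_normal. Qed.

Lemma nc_coset x : x \in G -> nc x = (coset Z x != 1).
Proof.
move=> Gx; rewrite in_setD Gx andbT; congr (~~ _); apply/idP/eqP.
  exact: coset_id.
by apply: coset_idr; rewrite (subsetP nZG).
Qed.

Lemma coset_center_inj x y : x \in G -> y \in G -> coset Z x = coset Z y ->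
  exists2 c, c \in Z & x = c * y.
Proof.
move=> Gx Gy /(rcoset_kercosetP (subsetP nZG x Gx) (subsetP nZG y Gy)).
by case/rcosetP=> c Zc ->; exists c.
Qed.

Lemma exists_nc_pelt (H : {group gT}) p : H \subset G -> prime p ->
  p %| #|H / Z| -> exists2 w, w \in H & nc w && p.-elt w.
Proof.
move=> sHG pr_p /Cauchy[//|y Hy oy].
have [|w [Hw pw] [nZw Dy]] := quotient_lift_elt Hy (_ : p.-elt y).
  by rewrite /p_elt oy pnat_id.
exists w => //; rewrite pw andbT nc_coset ?(subsetP sHG) // -Dy -order_gt1 oy.
exact: prime_gt1.
Qed.

Lemma nc_pelt_dvd (H : {group gT}) p w : H \subset G ->
  prime p -> w \in H -> nc w -> p.-elt w -> p %| #|H / Z|.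
Proof.
move=> sHG pr_p Hw ncw pw; have Gw := nc_G ncw.
have Hy : coset Z w \in H / Z by apply: mem_quotient.
have: p.-group <[coset Z w]> by rewrite [p.-group _]morph_p_elt // (subsetP nZG).
case/pgroup_pdiv=> [|_ p_dv _]; first by rewrite cycle_eq1 -nc_coset.
exact: dvdn_trans p_dv (order_dvdG Hy).
Qed.

Lemma pelt_expg_nc x p k : nc x -> p.-elt x -> p^'.-nat k -> nc (x ^+ k).
Proof.
move=> ncx px p'k; rewrite in_setD (groupX _ (nc_G ncx)) andbT.
case/setDP: ncx => _; apply: contra; apply: expg_coprime_mem.
exact: pnat_coprime px p'k.
Qed.

(** A noncentral [r]-element [w] of ['C_G[x]] lies in a conjugate of [R], which centralises it. Were
    ['C_G[w]] an [r]-group modulo [Z], it would lie in [Z] times that conjugate; so ['C_G[w]] is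
    abelian in every case, and equals ['C_G[x]]. *)
Lemma abelian_Sylow_component r (R : {group gT}) x :
    r.-Sylow(G) R -> abelian R -> prime r -> nc x -> r %| #|'C_G[x] / Z| ->
  exists2 g, g \in G &
    [/\ abelian 'C_G[x], R :^ g \subset 'C_G[x] & 'C_G[x] = 'C_G(R :^ g)].
Proof.
move=> sylR abR pr_r ncx r_dv; have Gx := nc_G ncx.
have [w Cw /andP[ncw rw]] := exists_nc_pelt (subsetIl _ _) pr_r r_dv.
have Gw := nc_G ncw.
have [|g Gg sRg] := Sylow_subJ sylR (_ : <[w]> \subset G) rw.
  by rewrite cycle_subG.
exists g => //; have Rgw : w \in R :^ g by rewrite -cycle_subG.
have sRgG : R :^ g \subset G by rewrite conj_subG // (pHall_sub sylR).
have abRg : abelian (R :^ g) by rewrite abelianJ.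
have sRgC : R :^ g \subset 'C_G[w].
  by rewrite subsetI sRgG sub_cent1 (subsetP abRg).
have sylRg : r.-Sylow(G) (R :^ g) by rewrite pHallJ.
have abCw : abelian 'C_G[w].
  have [//|[p pr_p pCw]] := cent1_dichotomy anti ncw.
  have Dp : p = r.
    apply: (pelt_uniq (coset_center_neq1 ncw) (cent1_quo_p ncw pCw)).
    by rewrite morph_p_elt // (subsetP nZG).
  rewrite {p pr_p}Dp in pCw; have sZC := center_sub_cent1 Gw.
  have sylRgC : r.-Sylow('C_G[w] / Z) (R :^ g / Z).
    rewrite quotient_pHall ?(subset_trans sRgG) //.
    exact: pHall_subl sRgC (subsetIl _ _) sylRg.
  have: 'C_G[w] / Z \subset (R :^ g) / Z by rewrite (pHall_id sylRgC pCw).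
  have nZC : 'C_G[w] \subset 'N(Z) by rewrite (subset_trans (subsetIl _ _)).
  rewrite quotientSK // => /abelianS; apply.
  rewrite abelianM center_abelian abRg (subset_trans sRgG) //.
  by rewrite centsC subsetIr.
have Cwx : 'C_G[w] = 'C_G[x].
  exact: cent1_abelian_eq (cent1_sym Gx Cw) abCw.
rewrite -Cwx; split=> //; apply/eqP; rewrite eqEsubset; apply/andP; split.
  by rewrite subsetI subsetIl (subset_trans abCw) // centS.
by rewrite setIS // -cent_cycle centS // cycle_subG.
Qed.

(** If a central [z] generated the only subgroup of order [r] of [R / Z], it would be a power of
    every nontrivial element; by the antichain condition all noncentral elements of [R] would share
    one centraliser, hence commute. *)
Lemma nonabelian_pgroup_plane r (R : {group gT}) :
    prime r -> r.-group R -> R \subset G -> ~~ abelian R ->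
  exists e f, [/\ e \in R / Z, f \in R / Z, commute e f, #[e] = r & #[f] = r]
              /\ e \notin <[f]>.
Proof.
move=> pr_r rR sRG nabR; have rRZ : r.-group (R / Z) by apply: quotient_pgroup.
have ntRZ : R / Z != 1.
  apply: contra nabR => /eqP/trivgP; rewrite quotient_sub1; last first.
    exact: subset_trans nZG.
  by move/abelianS; apply; apply: center_abelian.
have ntC : 'Z(R / Z) != 1.
  by apply: contra ntRZ => /eqP Z1; rewrite (trivg_center_pgroup rRZ Z1).
have r_dv := pgroup_dvd (pgroupS (center_sub _) rRZ) ntC.
have [z /setIP[RZz cRz] oz] := Cauchy pr_r r_dv.
have [/exists_inP[e RZe /andP[/eqP oe nze]]|/exists_inPn no_e] :=
  boolP [exists e in R / Z, (#[e] == r) && (e \notin <[z]>)].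
  by exists e, z; split=> //; split=> //; apply/commute_sym; apply: (centP cRz).
case/negP: nabR; have [z1 nZz1 Rz1 Dz] := morphimP RZz.
have Gz1 := subsetP sRG _ Rz1.
have ncz1 : nc z1 by rewrite nc_coset // -[coset Z z1]Dz -order_gt1 oz prime_gt1.
have Cz1 w : w \in R -> nc w -> 'C_G[w] = 'C_G[z1].
  move=> Rw ncw; have Gw := nc_G ncw.
  have RZw : coset Z w \in R / Z by apply: mem_quotient.
  have rdvw : r %| #|<[coset Z w]>|.
    apply: pgroup_dvd; last by rewrite cycle_eq1 -nc_coset.
    by apply: pgroupS rRZ; rewrite cycle_subG.
  have [e we oe] := Cauchy pr_r rdvw.
  have RZe : e \in R / Z by apply: subsetP we; rewrite cycle_subG.
  have := no_e e RZe; rewrite oe eqxx negbK /= => ze.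
  have : z \in <[coset Z w]>.
    apply: (subsetP _ _ (cycle_id z)); suff <- : <[e]> = <[z]> by rewrite cycle_subG.
    by apply/eqP; rewrite eqEcard cycle_subG ze -!orderE oe oz leqnn.
  case/cycleP=> k; rewrite Dz -morphX ?(subsetP nZG) //= => eq_wk.
  have [c Zc Dz1] := coset_center_inj Gz1 (groupX k Gw) eq_wk.
  apply: (cent1_sub_eq anti) => //; apply/subsetP=> y /setIP[Gy cwy].
  have [_ cGc] := setIP Zc; rewrite inE Gy /=; apply/cent1P; rewrite Dz1.
  apply: commuteM; first exact/commute_sym/(centP cGc).
  by apply: commuteX; apply/cent1P.
apply/centsP=> w Rw v Rv; have [Gw Gv] := (subsetP sRG _ Rw, subsetP sRG _ Rv).
have [Zw | nZw] := boolP (w \in Z); first by case/setIP: Zw => _ /centP; apply.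
have [Zv | nZv] := boolP (v \in Z).
  by apply/commute_sym; case/setIP: Zv => _ /centP; apply.
have: v \in 'C_G[w] by rewrite Cz1 ?in_setD ?nZw // -(Cz1 v) ?in_setD ?nZv // cent1_id.
by case/setIP=> _ /cent1P/commute_sym.
Qed.

Section AbelianComponent.

Variable x : gT.
Hypotheses (ncx : nc x) (abD : abelian 'C_G[x]).

Local Notation D := 'C_G[x].
Local Notation N := 'N_G('C_G[x]).

Let Gx := nc_G ncx.

Let sDN : D \subset N. Proof. by rewrite subsetI subsetIl normG. Qed.

Lemma component_normal : D <| N.
Proof. by rewrite /normal sDN subsetIr. Qed.

Lemma component_cent1 d : d \in D -> nc d -> 'C_G[d] = D.
Proof. by move=> Dd ncd; rewrite -(cent1_abelian_eq anti ncx ncd Dd). Qed.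

(* A noncentral element of [D] has centraliser [D], so an element of [N :\: D]
   cannot have a noncentral power in [D]. *)
Lemma component_mul_expg y d p : y \in N :\: D -> prime p ->
  y ^+ p \in D -> d \in D -> (d * y) ^+ p \in Z.
Proof.
case/setDP=> Ny nDy pr_p Dyp Dd; have nDNy : y \in 'N(D) by case/setIP: Ny.
have Nd := subsetP sDN _ Dd; have nDd : d \in 'N(D) by case/setIP: Nd.
have Gdy : d * y \in G by case/setIP: (groupM Nd Ny).
have Dw : (d * y) ^+ p \in D.
  apply: coset_idr; rewrite ?groupX ?groupM // morphX ?groupM // morphM //=.
  by rewrite (coset_id Dd) mul1g -morphX //= coset_id.
apply: contraR nDy => nZw; have ncw : nc ((d * y) ^+ p).
  by rewrite in_setD nZw groupX.
have: d * y \in 'C_G[(d * y) ^+ p].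
  by rewrite inE Gdy; apply/cent1P/commuteX.
by rewrite (component_cent1 Dw ncw) groupMl.
Qed.

Section Prime.

Variables (s q : nat) (S : {group gT}).
Hypotheses (pr_s : prime s) (pr_q : prime q) (neq_qs : q != s).
Hypotheses (sylS : s.-Sylow(G) S) (nabS : ~~ abelian S).
Hypotheses (s_dv : s %| #|D / Z|) (q_dv : q %| #|D / Z|).

(* Fix [u] in [O_s(D)], central of order [s] modulo [Z] in [S1 / Z]: then
   [h |-> [~ u, h]] embeds [S1 / D] into [Z] as an elementary abelian group.  By
   [component_mul_expg] all norms of [N / D] on [D] fall into [Z]; hence an
   elementary abelian subgroup of order [s ^ 2], or a Frobenius group with kernel
   [H], would give [d ^+ s \in Z] for the [q]-elements [d] of [D], which fails;
   and an [s']-element centralising [H] would fix [u] modulo [Z], then lie in [D]. *)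
Lemma component_Sylow : exists H : {group coset_of D},
  [/\ s.-Sylow(N / D) H, #|H| = s & 'N_(N / D)(H) = H].
Proof.
have sDG : D \subset G := subsetIl _ _.
have sNG : N \subset G := subsetIl _ _.
have nZN : N \subset 'N(Z) := subset_trans sNG nZG.
have nDN : N \subset 'N(D) := subsetIr _ _.
have no_power k : prime k -> k != q -> ~ (forall d, d \in D -> d ^+ k \in Z).
  move=> pr_k neq_kq Zk; have [d Dd /andP[ncd qd]] := exists_nc_pelt sDG pr_q q_dv.
  have: nc (d ^+ k) by apply: pelt_expg_nc qd _; rewrite // pnatE.
  by case/setDP=> _ /negP[]; apply: Zk.
have [S1 sylS1] := Sylow_exists s N; have [sS1N sS1 _] := and3P sylS1.
pose Ds := 'O_s(D).
have nDsN : Ds <| N by apply: char_normal_trans (pcore_char _ _) component_normal.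
have sDsS1 : Ds \subset S1.
  exact: normal_sub_max_pgroup (Hall_max sylS1) (pcore_pgroup _ _) nDsN.
have [d0 Dd0 /andP[ncd0 sd0]] := exists_nc_pelt sDG pr_s s_dv.
have Dsd0 : d0 \in Ds by apply: mem_pcore_abelian.
have sS1Z : s.-group (S1 / Z) by apply: quotient_pgroup.
have ntDsZ : Ds / Z != 1.
  apply/trivgPn; exists (coset Z d0); first exact: mem_quotient.
  by rewrite -nc_coset ?(nc_G ncd0).
have nsDsS1 : Ds / Z <| S1 / Z.
  by apply: quotient_normal; apply: normalS nDsN.
have ntI : (Ds / Z) :&: 'Z(S1 / Z) != 1.
  by apply: meet_center_nil => //; apply: pgroup_nil sS1Z.
have s_dvI : s %| #|(Ds / Z) :&: 'Z(S1 / Z)|.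
  apply: pgroup_dvd ntI; apply: pgroupS sS1Z.
  by rewrite (subset_trans (subsetIl _ _)) ?normal_sub.
have [ub /setIP[/morphimP[u nZu Dsu Dub] /setIP[_ cub]] oub] := Cauchy pr_s s_dvI.
rewrite /= in Dub; have S1u := subsetP sDsS1 _ Dsu.
have Du := subsetP (pcore_sub _ _) _ Dsu; have Gu := subsetP sDG _ Du.
have su : s.-elt u := mem_p_elt (pcore_pgroup _ _) Dsu.
have ncu : nc u by rewrite nc_coset // -Dub -order_gt1 oub prime_gt1.
have Zus : u ^+ s \in Z.
  by apply: coset_idr; rewrite ?groupX // morphX // -oub /= -Dub expg_order.
have CuD := component_cent1 Du ncu.
have ZR h : h \in S1 -> [~ u, h] \in Z.
  move=> S1h; have nZh : h \in 'N(Z) by rewrite (subsetP nZN) ?(subsetP sS1N).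
  apply: coset_idr; rewrite ?groupR // morphR //= -Dub.
  by apply/eqP/commgP; apply: (centP cub); apply: mem_quotient.
have cZ c y : c \in Z -> y \in G -> commute c y.
  by case/setIP=> _ /centP; apply.
have D_of_cu h : h \in G -> [~ u, h] = 1 -> h \in D.
  by move=> Gh /eqP/commgP cuh; rewrite -CuD inE Gh; apply/cent1P.
pose H := (S1 / D)%G; have sylH : s.-Sylow(N / D) H.
  exact: quotient_pHall (subset_trans sS1N nDN) sylS1.
have sHV : H \subset N / D := pHall_sub sylH.
have sS1G : S1 \subset G := subset_trans sS1N sNG.
have S1cosets v : v \in H -> exists2 h, h \in S1 & v = coset D h.
  by case/morphimP=> h _ S1h ->; exists h.
have conj_u h : h \in S1 -> exists2 c, c \in Z & u ^ h = u * c.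
  by move=> S1h; exists [~ u, h]; rewrite ?ZR // conjg_mulR.
have GS1 := subsetP sS1G.
have ZJ c y : c \in Z -> y \in G -> c ^ y = c.
  by move=> Zc Gy; apply/conjg_fixP/commgP; apply: cZ.
have D_of_fix h : h \in S1 -> u ^ h = u -> h \in D.
  by move=> S1h /conjg_fixP/eqP; apply: D_of_cu; apply: GS1.
have conj_uC h1 h2 : h1 \in S1 -> h2 \in S1 -> u ^ (h1 * h2) = u ^ (h2 * h1).
  move=> S1h1 S1h2; have [c1 Zc1 D1] := conj_u h1 S1h1.
  have [c2 Zc2 D2] := conj_u h2 S1h2.
  rewrite !conjgM D1 D2 !conjMg D1 D2 (ZJ c1) ?(ZJ c2) ?GS1 // -!mulgA.
  by congr (_ * _); apply: cZ => //; case/setIP: Zc1.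
have abelH : s.-abelem H.
  apply/(abelemP pr_s); split=> [|_ /S1cosets[h S1h ->]].
    apply: quotient_cents2r; rewrite gen_subG.
    apply/subsetP=> _ /imset2P[h1 h2 S1h1 S1h2 ->].
    apply: D_of_fix; first exact: groupR.
    rewrite commgEl conjgE !mulgA -[_ * h2]mulgA conjgM conj_uC ?groupV //.
    by rewrite -conjgM -mulgA mulKg mulVg conjg1.
  have [c Zc Duh] := conj_u h S1h.
  have Duk k : u ^ (h ^+ k) = u * c ^+ k.
    elim: k => [|k IHk]; first by rewrite conjg1 mulg1.
    rewrite expgSr conjgM IHk conjMg Duh (ZJ (c ^+ k)) ?groupX ?GS1 //.
    by rewrite -mulgA -expgS.
  have cs1 : c ^+ s = 1.
    apply: (mulgI (u ^+ s)); rewrite -expgMn; last exact/commute_sym/cZ.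
    by rewrite -Duh -conjXg ZJ ?GS1 // mulg1.
  rewrite -morphX ?(subsetP nDN) ?(subsetP sS1N) //= coset_id //.
  by apply: D_of_fix; rewrite ?groupX // Duk cs1 mulg1.
have ntH : H :!=: 1.
  apply: contra nabS => /eqP/trivgP; rewrite quotient_sub1; last first.
    exact: subset_trans sS1N nDN.
  (* If [S1] lies in [D], then [D = 'C_G(S1)], so ['N_G(S1)] lies in [N] and [S1] is a Sylow
     subgroup of [G] inside the abelian [D]. *)
  move=> sS1D; have DcS1 : D = 'C_G(S1).
    apply/eqP; rewrite eqEsubset; apply/andP; split.
      by rewrite subsetI sDG centsC (subset_trans sS1D).
    suff: 'C_G(S1) \subset 'C_G[u] by rewrite CuD.
    by rewrite setIS // -cent_cycle centS // cycle_subG.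
  have sNSN : 'N_G(S1) \subset N.
    rewrite DcS1 subsetI subsetIl normsI ?norms_cent ?subsetIr //.
    by rewrite (subset_trans (subsetIl _ _)) ?normG.
  have sylS1' : s.-Sylow(G) S1.
    by rewrite -Sylow_subnorm (pHall_subl _ sNSN) // subsetI sS1G normG.
  have [g _ ->] := Sylow_trans sylS1' sylS.
  by rewrite abelianJ (abelianS sS1D).
have norm_sub y d p : y \in N :\: D -> prime p -> y ^+ p \in D -> d \in D ->
  (d * y) ^+ p \in Z by apply: component_mul_expg.
have [f Hf ntf] := trivgPn _ ntH.
have of_ : #[f] = s.
  have [_ expH] := abelemP pr_s abelH.
  by apply: nt_prime_order => //; apply: expH.
have DH : H :=: <[f]>.
  apply/eqP; rewrite eq_sym eqEsubset cycle_subG Hf.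
  apply/subsetP=> e He; apply/negPn/negP=> nfe.
  have [abH expH] := abelemP pr_s abelH.
  have oe : #[e] = s.
    apply: nt_prime_order => //; first exact: expH.
    by apply: contraNneq nfe => ->; apply: group1.
  case: (no_power s) => // [|d Dd]; first by rewrite eq_sym.
  rewrite -oe; apply: (quotient_plane_norm abD norm_sub) nfe Dd.
  - exact: subsetP sHV e He.
  - exact: subsetP sHV f Hf.
  - exact: (centsP abH).
  - by rewrite oe.
  - by rewrite oe of_.
exists H; split=> //; first by rewrite DH -orderE of_.
have [sNH | nsNH] := boolP ('N_(N / D)(H) \subset H).
  by apply/eqP; rewrite eqEsubset sNH subsetI sHV normG.
have [t pr_t [t_dv nt_s]] : exists2 t, prime t & t %| #|'N_(N / D)(H)| /\ t != s.
  have sylHN : s.-Sylow('N_(N / D)(H)) H.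
    by apply: pHall_subl sylH; rewrite ?subsetIl // subsetI sHV normG.
  have [_ _ s'i] := and3P sylHN; set i := #|_ : _| in s'i.
  have i_gt1 : i > 1 by rewrite indexg_gt1.
  exists (pdiv i); first exact: pdiv_prime.
  split; first exact: dvdn_trans (pdiv_dvd _) (dvdn_indexg _ _).
  by have := pnat_dvd (pdiv_dvd _) s'i; rewrite pnatE ?pdiv_prime.
have [v /setIP[Vv nHv] ov] := Cauchy pr_t t_dv.
have [regHv|nregHv] := eqVneq 'C_H[v] 1.
  case: (no_power s) => // [|d Dd]; first by rewrite eq_sym.
  rewrite -of_.
  apply: (quotient_Frobenius_norm abD norm_sub _ Vv) Dd.
  - exact: subsetP sHV f Hf.
  - by rewrite -DH.
  - by rewrite of_.
  - by rewrite ov.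
  - by rewrite -DH.
have cHv : H \subset 'C[v].
  apply: contraR nregHv => nsHC; apply/eqP/prime_TIg => //.
  by rewrite DH -orderE of_.
have [y nDy Ny Dv] := morphimP Vv; have [h S1h Df] := S1cosets f Hf.
have nDh : h \in 'N(D) by rewrite (subsetP nDN) ?(subsetP sS1N).
have Gy := subsetP sNG _ Ny; have [c Zc Duh] := conj_u h S1h.
have Duy : u ^ y \in D by rewrite memJ_norm.
have [d Dd Dhy] : exists2 d, d \in D & h ^ y = d * h.
  apply/rcosetP; apply/rcoset_kercosetP; rewrite ?groupJ //.
  rewrite morphJ //= -Df -[coset _ y]Dv; apply/conjg_fixP/commgP.
  exact/cent1P/(subsetP cHv).
have Duyh : (u ^ y) ^ h = u ^ y * c.
  have <- : (u ^ y) ^ (h ^ y) = u ^ y * c.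
    by rewrite -conjJg Duh conjMg (ZJ c).
  rewrite Dhy conjgM; congr (_ ^ h); apply/esym/conjg_fixP/commgP.
  exact: (centsP abD).
pose k := u ^ y * u^-1; have Dk : k \in D by rewrite groupM ?groupV.
(* Since [h ^ y] is in [D * h], conjugation by [h] multiplies [u ^ y] and [u] by the same [c], so it
   fixes [k]; a noncentral [k] would put [h] in ['C_G[k] = D]. *)
have Zk : k \in Z.
  apply: contraR ntf => nZk; rewrite Df; apply/eqP/coset_id.
  have nck : nc k by rewrite in_setD nZk (subsetP sDG).
  rewrite -(component_cent1 Dk nck) inE GS1 //; apply/cent1P/commute_sym.
  apply/commgP/conjg_fixP.
  rewrite conjMg conjVg Duyh Duh invMg -mulgA; congr (_ * _).
  by rewrite mulKVg.
have ntDy : y \in N :\: D.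
  rewrite in_setD Ny andbT; apply: contraTN pr_t => /coset_id Dy1.
  by rewrite -ov Dv /= Dy1 order1.
have Dyt : y ^+ t \in D.
  by apply: coset_idr; rewrite ?groupX // morphX //= -[coset D y]Dv -ov expg_order.
(* Both [(u * y) ^+ t] and [y ^+ t] are central, and [y] commutes with [u] modulo [Z]: thus [u ^+ t]
   is central, impossible for a noncentral [s]-element [u]. *)
have Zuyt := norm_sub y u t ntDy pr_t Dyt Du.
have Zyt := norm_sub y 1 t ntDy pr_t Dyt (group1 _); rewrite mul1g in Zyt.
have ncut : nc (u ^+ t) by apply: pelt_expg_nc su _ => //; rewrite pnatE.
case/eqP: (coset_center_neq1 ncut); have nZy := subsetP nZG _ Gy.
have cuy : commute (coset Z u) (coset Z y).
  apply/commgP/conjg_fixP; rewrite -morphJ //=.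
  rewrite -(mulgKV u (u ^ y)) -/k morphM //= ?(coset_id Zk) ?mul1g //.
  by rewrite groupMl ?groupJ ?groupV.
have := coset_id Zuyt; rewrite morphX ?groupM // morphM //= expgMn //.
by rewrite -(morphX _ _ nZy) /= (coset_id Zyt) mulg1 -morphX.
Qed.

End Prime.

End AbelianComponent.

End Components.

(** * Counting with TI subgroups *)

Lemma selfnormal_prime_TI (gT : finGroupType) (V H : {group gT}) :
  prime #|H| -> H \subset V -> 'N_V(H) = H -> normedTI H^# V H.
Proof.
move=> prH sHV NH; apply/normedTI_P; split.
- by rewrite setD_eq0 subG1 -cardG_gt1 prime_gt1.
- by rewrite -{1}NH setIS // normD1.
move=> g Vg /pred0Pn[y /andP[/setD1P[nty Hy]]]; rewrite /= conjD1g.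
move=> /setD1P[_ Hgy]; rewrite -NH inE Vg.
have eqH : H :&: H :^ g = H.
  apply/eqP; apply: contraR nty => neqH.
  have : y \in H :&: H :^ g by rewrite inE Hy.
  rewrite prime_TIg ?inE //; apply: contra neqH => sHHg.
  by apply/eqP/setIidPl.
apply/normP/eqP; rewrite eq_sym eqEcard cardJg leqnn andbT.
by apply/setIidPl.
Qed.

Lemma selfnormal_prime_card (gT : finGroupType) (V H : {group gT}) :
  prime #|H| -> H \subset V -> 'N_V(H) = H ->
  #|V| <= 2 * #|class_support H^# V|.
Proof.
move=> prH sHV NH; rewrite (card_support_normedTI (selfnormal_prime_TI prH sHV NH)).
rewrite -(Lagrange sHV) mulnA leq_mul2r; apply/orP; right.
rewrite (cardsD1 1 H) group1 mul2n -addnn add1n -addn1 leq_add2l.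
by have := prime_gt1 prH; rewrite (cardsD1 1 H) group1.
Qed.

Section NonabelianSylows.

Variables (gT : finGroupType) (G : {group gT}).
Hypothesis anti : cent_antichain G.

Local Notation Z := 'Z(G).
Local Notation nc x := (x \in G :\: 'Z(G)).

(* Self-normalising Sylow subgroups of prime orders [s != t] would each have
   conjugates covering at least half of [N / D]. *)
Lemma component_nonabelian_Sylow x (s t : nat) (S T : {group gT}) :
    nc x -> abelian 'C_G[x] -> prime s -> prime t -> s != t ->
    s %| #|'C_G[x] / Z| -> t %| #|'C_G[x] / Z| ->
    s.-Sylow(G) S -> t.-Sylow(G) T -> ~~ abelian S -> ~~ abelian T -> False.
Proof.
move=> ncx abD pr_s pr_t neq_st s_dv t_dv sylS sylT nabS nabT.
have [|H [sylH oH NH]] := component_Sylow anti ncx abD pr_s pr_t _ sylS nabS s_dv t_dv.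
  by rewrite eq_sym.
have [K [sylK oK NK]] := component_Sylow anti ncx abD pr_t pr_s neq_st sylT nabT t_dv s_dv.
set V := ('N_G('C_G[x]) / 'C_G[x])%G in sylH NH sylK NK.
have [sHV sKV] := (pHall_sub sylH, pHall_sub sylK).
have oHV := @selfnormal_prime_card _ V H; rewrite oH in oHV.
have oKV := @selfnormal_prime_card _ V K; rewrite oK in oKV.
have := leq_add (oHV pr_s sHV NH) (oKV pr_t sKV NK).
rewrite -mulnDr addnn -mul2n leq_mul2l /= -cardsUI.
set A := _ :|: _; have -> : class_support H^# V :&: class_support K^# V = set0.
  apply/eqP; rewrite -subset0; apply/subsetP=> y /setIP[].
  case/imset2P=> h g1 /setD1P[nth Hh] Vg1 ->.
  case/imset2P=> k g2 /setD1P[ntk Kk] Vg2 eqhk.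
  case/eqP: neq_st; apply: (pelt_uniq nth).
    exact: mem_p_elt (pHall_pgroup sylH) Hh.
  rewrite -(p_eltJ _ _ g1) eqhk p_eltJ.
  exact: mem_p_elt (pHall_pgroup sylK) Kk.
(* The two disjoint supports would have to fill [V], but both miss [1]. *)
rewrite cards0 addn0 leqNgt => /negP[]; apply: proper_card.
apply: (sub_proper_trans (B := V^#)); last by rewrite properD1.
rewrite subUset; apply/andP; split; apply/subsetP=> _ /imset2P[y g /setD1P[nty Hy] Vg ->].
  by rewrite !inE conjg_eq1 nty groupJ // (subsetP sHV).
by rewrite !inE conjg_eq1 nty groupJ // (subsetP sKV).
Qed.

End NonabelianSylows.

Lemma normal_index_dvd (gT : finGroupType) (X N B : {group gT}) :
  N <| X -> B \subset X -> #|N : B| %| #|X : B|.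
Proof.
case/andP=> sNX nNX sBX; rewrite -indexMg -norm_joinEl ?(subset_trans sBX) //.
have sJX : B <*> N \subset X by rewrite join_subG sBX.
by rewrite -(Lagrange_index sJX (joing_subl _ _)) dvdn_mull.
Qed.

Section TIPartition.

Variable gT : finGroupType.
Implicit Types X A B : {group gT}.

(* [A] is a Frobenius complement; its kernel [K] is the union of the conjugates of
   [B], so [#|K| = 1 + (#|B| - 1) * #|X : 'N_X(B)|] is prime to the number of those
   conjugates, which forces [B <| K]. *)
Lemma selfnormal_TI_partition X A B :
    abelian A -> abelian B -> normedTI A^# X A -> normedTI B^# X 'N_X(B) ->
    X^# = class_support A^# X :|: class_support B^# X ->
    [disjoint class_support A^# X & class_support B^# X] ->
  solvable X /\ [Frobenius X].
Proof.
move=> abA abB tiA tiB defX disj; have [ntB sNB _] := normedTI_P tiB.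
have [ntA sAX _] := normedTI_memJ_P tiA.
have sBX : B \subset X.
  apply/subsetP=> b Bb; have [->|ntb] := eqVneq b 1; first exact: group1.
  have : b \in X^# by rewrite defX inE orbC mem_class_support // !inE ntb.
  by case/setD1P.
have [b /setD1P[ntb Bb]] := set0Pn _ ntB.
have frobX : [Frobenius X with complement A].
  rewrite /Frobenius_group_with_complement tiA andbT; apply: contraTneq disj => DA.
  apply/pred0Pn; exists b; apply/andP; split; apply: mem_class_support.
    by rewrite !inE ntb DA (subsetP sBX).
  by rewrite !inE ntb.
split; last by apply/existsP; exists A.
have [K frobK] := Frobenius_kernel_exists frobX.
have [defXK _ _ _ _] := Frobenius_context frobK.
have [nsKX _ _ nKA tiKA] := sdprod_context defXK; have sKX := normal_sub nsKX.
have DK : K^# = class_support B^# X.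
  apply/eqP; rewrite eqEsubset; apply/andP; split; apply/subsetP=> k.
    case/setD1P=> ntk Kk; have : k \in X^# by rewrite !inE ntk (subsetP sKX).
    rewrite defX => /setUP[|//] /imset2P[a g /setD1P[nta Aa] Xg Dk].
    case/eqP: nta; apply/set1P; rewrite -set1gE -tiKA inE Aa andbT.
    by rewrite -(memJ_norm _ (subsetP (normal_norm nsKX) g Xg)) -Dk.
  move=> csk; have : k \in X^# by rewrite defX inE csk orbT.
  case/setD1P=> ntk Xk; rewrite !inE ntk; have := Frobenius_partition frobK.
  case/and3P=> /eqP/setP/(_ k) + _ _; rewrite Xk => /bigcupP[C] /setU1P[-> //|].
  case/imsetP=> h Kh -> /imsetP[a /setD1P[nta Aa] Dk].
  have : k \in class_support A^# X.
    by rewrite Dk memJ_class_support ?(subsetP sKX) // !inE nta.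
  by move/(disjointFr disj); rewrite csk.
have oK : #|K| = (#|B|.-1 * #|X : 'N_X(B)|).+1.
  rewrite (cardsD1 1 K) group1 DK (card_support_normedTI tiB).
  by rewrite [in RHS](cardsD1 1 B) group1.
have sBK : B \subset K.
  apply/subsetP=> y By; have [->|nty] := eqVneq y 1; first exact: group1.
  have : y \in K^# by rewrite DK mem_class_support // !inE nty.
  by case/setD1P.
have co_i : coprime #|K| #|X : 'N_X(B)|.
  by rewrite oK -addn1 coprime_sym /coprime gcdnMDl gcdn1.
have nBK : K \subset 'N(B).
  suff: #|K : 'N_X(B)| %| 1.
    by rewrite dvdn1 indexg_eq1 subsetI => /andP[].
  by rewrite -(eqP co_i) dvdn_gcd dvdn_indexg normal_index_dvd ?subsetIl.
have sKF : K \subset 'F(K).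
  apply/subsetP=> k Kk; have [->|ntk] := eqVneq k 1; first exact: group1.
  have : k \in K^# by rewrite !inE ntk.
  rewrite DK => /imset2P[y g /setD1P[_ By] Xg ->].
  have nKg := normP (subsetP (normal_norm nsKX) g Xg).
  have: B :^ g \subset 'F(K).
    apply: Fitting_max; last by rewrite abelian_nil ?abelianJ.
    by rewrite /normal -{1 2}nKg conjSg sBK normJ conjSg.
  by move/subsetP; apply; rewrite memJ_conjg.
have nilK : nilpotent K by apply: nilpotentS sKF (Fitting_nil K).
rewrite (series_sol nsKX) nilpotent_sol //=.
by rewrite -(isog_sol (sdprod_isog defXK)) abelian_sol.
Qed.

(** If neither subgroup is self-normalising, each support has at most [#|X| / 2 - 1] elements, so
    the two supports and [1] cannot fill [X]. *)
Lemma TI_partition X A B :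
    abelian A -> abelian B -> normedTI A^# X 'N_X(A) -> normedTI B^# X 'N_X(B) ->
    A \subset X -> B \subset X ->
    X^# = class_support A^# X :|: class_support B^# X ->
    [disjoint class_support A^# X & class_support B^# X] ->
  solvable X /\ [Frobenius X].
Proof.
move=> abA abB tiA tiB sAX sBX defX disj.
have [sNA | nsNA] := boolP ('N_X(A) \subset A).
  have NA : 'N_X(A) = A by apply/eqP; rewrite eqEsubset sNA subsetI sAX normG.
  by rewrite NA in tiA; apply: (selfnormal_TI_partition abA abB tiA tiB).
have [sNB | nsNB] := boolP ('N_X(B) \subset B).
  have NB : 'N_X(B) = B by apply/eqP; rewrite eqEsubset sNB subsetI sBX normG.
  rewrite NB in tiB; apply: (selfnormal_TI_partition abB abA tiB tiA).
    by rewrite setUC.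
  by rewrite disjoint_sym.
have bound (C : {group gT}) : C \subset X -> normedTI C^# X 'N_X(C) ->
    ~~ ('N_X(C) \subset C) -> 2 * (#|class_support C^# X|).+1 <= #|X|.
  move=> sCX tiC nsNC; rewrite (card_support_normedTI tiC).
  have sCN : C \subset 'N_X(C) by rewrite subsetI sCX normG.
  have i_gt1 : 1 < #|'N_X(C) : C| by rewrite indexg_gt1.
  rewrite -(Lagrange (subsetIl X 'N(C))) -(Lagrange sCN) mulnAC mulnC.
  apply: leq_mul i_gt1; rewrite [X in _ < X * _](cardsD1 1 C) group1 add1n mulSn.
  by rewrite -addn1 addnC leq_add2r indexg_gt0.
have := leq_add (bound A sAX tiA nsNA) (bound B sBX tiB nsNB).
rewrite -mulnDr addnn -mul2n leq_mul2l /= leqNgt => /negP[].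
rewrite (cardsD1 1 X) group1 defX cardsU (disjoint_setI0 disj) cards0 subn0.
by rewrite addSn addnS add1n.
Qed.

End TIPartition.

(** * The images of abelian centralisers in [G / Z] *)

Section Partition.

Variables (gT : finGroupType) (G : {group gT}).
Hypothesis anti : cent_antichain G.

Local Notation Z := 'Z(G).
Local Notation nc x := (x \in G :\: 'Z(G)).

Let nZG : G \subset 'N(Z). Proof. exact/normal_norm/center_normal. Qed.

Lemma cent1_subgJ x g : g \in G -> 'C_G[x ^ g] = 'C_G[x] :^ g.
Proof. by move=> Gg; rewrite conjIg conjGid // cent1J. Qed.

Lemma nc_conjg x g : g \in G -> nc (x ^ g) = nc x.
Proof.
by move=> Gg; rewrite !in_setD (groupJr _ Gg) (memJ_norm _ (subsetP nZG g Gg)).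
Qed.

Lemma cent1_centerM c x : c \in Z -> 'C_G[c * x] = 'C_G[x].
Proof.
case/setIP=> Gc /centP cGc; apply/setP=> y; rewrite !in_setI.
have [Gy /=|//] := boolP (y \in G); have cyc := commute_sym (cGc y Gy).
apply/cent1P/cent1P=> [cy|]; last exact: commuteM.
by rewrite -(mulKg c x); apply: commuteM cy; apply: commuteV.
Qed.

Lemma mem_component_support x w : nc x -> abelian 'C_G[x] -> nc w ->
  reflect (exists2 g, g \in G & 'C_G[w] = 'C_G[x] :^ g)
    (coset Z w \in class_support ('C_G[x] / Z)^# (G / Z)).
Proof.
move=> ncx abD ncw; have Gw := nc_G ncw; apply: (iffP idP) => [|[g Gg DCw]].
  case/imset2P=> yb _ /setD1P[nty /morphimP[y nZy Dy Dyb]] /morphimP[g nZg Gg ->].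
  rewrite {yb}Dyb /= in nty *; rewrite -morphJ //= => Dw; have Gy : y \in G by case/setIP: Dy.
  have [c Zc ->] := coset_center_inj Gw (groupJ Gy Gg) Dw.
  exists g => //; rewrite cent1_centerM // cent1_subgJ //; congr (_ :^ g).
  rewrite -(component_cent1 anti ncx abD Dy) //.
  by rewrite nc_coset.
have: w \in 'C_G[x] :^ g by rewrite -DCw cent1_id.
case/imsetP=> y Dy Dw; have nZy : y \in 'N(Z).
  by rewrite (subsetP nZG) //; case/setIP: Dy.
have nZg := subsetP nZG g Gg; have ncy : nc y by rewrite -(nc_conjg _ Gg) -Dw.
rewrite Dw morphJ //=; apply: memJ_class_support.
  by rewrite in_setD1 coset_center_neq1 ?mem_quotient.
exact: mem_quotient.
Qed.

(** Lifts of a nontrivial element common to the image and a conjugate differ by a central factor, so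
    they have one centraliser, which is both components. *)
Lemma component_TI x : nc x -> abelian 'C_G[x] ->
  normedTI ('C_G[x] / Z)^# (G / Z) 'N_(G / Z)('C_G[x] / Z).
Proof.
move=> ncx abD; have Gx := nc_G ncx; apply/normedTI_P; split.
- apply/set0Pn; exists (coset Z x).
  by rewrite in_setD1 coset_center_neq1 // mem_quotient // cent1_id.
- by rewrite setIS // normD1.
move=> gb Ggb; case/morphimP: (Ggb) => g nZg Gg Dg.
case/pred0Pn=> y /andP[/= /setD1P[nty Dy]]; rewrite conjD1g => /setD1P[_].
rewrite Dg -quotientJ // => Dgy.
have [y1 nZy1 Dy1 Ey1] := morphimP Dy; have [y2 nZy2 Dy2 Ey2] := morphimP Dgy.
have Gy1 : y1 \in G by case/setIP: Dy1.
have Gy2 : y2 \in G.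
  by apply: subsetP Dy2; rewrite conj_subG ?subsetIl.
have ncy1 : nc y1 by rewrite nc_coset // -[coset Z y1]Ey1.
have ncy2 : nc y2 by rewrite nc_coset // -[coset Z y2]Ey2.
have [|c Zc Dy12] := coset_center_inj Gy1 Gy2; first by rewrite -[LHS]Ey1 Ey2.
have Dxg : 'C_G[x] :^ g = 'C_G[x].
  have ncxg : nc (x ^ g) by rewrite nc_conjg.
  have abDg : abelian 'C_G[x ^ g] by rewrite cent1_subgJ // abelianJ.
  rewrite -cent1_subgJ // in Dy2 *.
  rewrite -(component_cent1 anti ncxg abDg Dy2 ncy2) -(cent1_centerM _ Zc).
  by rewrite -Dy12 (component_cent1 anti ncx abD Dy1 ncy1).
rewrite Dg in Ggb; apply/setIP; split=> //; apply/normP.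
by rewrite -quotientJ // Dxg.
Qed.

End Partition.

(** * Solvability criteria *)

Section PrimePowerIndex.

Implicit Types gT : finGroupType.

(** Burnside's theorem on conjugacy classes of prime power size, proved with characters. *)
Lemma simple_class_pnat gT (X : {group gT}) (r : nat) x :
  simple X -> x \in X -> x != 1 -> r.-nat #|x ^: X| -> abelian X.
Proof.
move=> simX Xx ntx rx; apply: contraT => nabX.
have Cx : x ^: X \in (classes X)^#.
  by rewrite !inE classG_eq1 ntx mem_classes.
have := primes_class_simple_gt1 simX nabX Cx.
rewrite ltnNge => /negP[]; apply: (@uniq_leq_size _ _ [:: r]).
  exact: primes_uniq.
move=> q; rewrite mem_primes => /and3P[pr_q _ /pnat_dvd/(_ rx)].
by rewrite pnatE // => /eqnP->; rewrite inE.
Qed.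

(** The hypothesis passes to a normal subgroup and its quotient. In a simple [X], the class size of
    a nontrivial element of [B] divides [#|X : B|]. *)
Lemma solvable_abelian_index gT (X B : {group gT}) (r : nat) :
  abelian B -> B \subset X -> r.-nat #|X : B| -> solvable X.
Proof.
move: {2}_.+1 (ltnSn #|X|) => n; elim: n => // n IHn in gT X B *.
rewrite ltnS => leXn abB sBX rXB; have [simX | ] := boolP (simple X); last first.
  rewrite negb_forall_in => /exists_inP[N sNX]; rewrite eq_sym.
  have [->|] := eqVneq N X.
    rewrite groupP /= genGid normG andbT eqb_id negbK => /eqP->.
    exact: solvable1.
  rewrite [N == X]eqEproper sNX eqbF_neg !negbK => ltNX /and3P[grN].
  case/isgroupP: grN => {}N -> in sNX ltNX *; rewrite /= genGid => ntN nNX.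
  have nsNX: N <| X by apply/andP.
  have nNB := subset_trans sBX nNX.
  rewrite (series_sol nsNX); apply/andP; split.
    apply: (IHn _ N (N :&: B)%G); rewrite ?subsetIl //.
    - by apply: leq_trans leXn; apply: proper_card.
    - exact: abelianS (subsetIr _ _) abB.
    by rewrite indexgI (pnat_dvd (normal_index_dvd nsNX sBX)).
  apply: (IHn _ (X / N)%G (B / N)%G).
  - by apply: leq_trans leXn; apply: ltn_quotient.
  - exact: quotient_abelian.
  - exact: quotientS.
  apply: pnat_dvd rXB; apply: index_quotient.
  by rewrite subIset ?nNB ?orbT.
have [B1 | /trivgPn[b Bb ntb]] := eqVneq B 1%G.
  by apply: (@pgroup_sol _ r); rewrite /pgroup; rewrite B1 indexg1 in rXB.
apply: abelian_sol; apply: (simple_class_pnat simX (subsetP sBX b Bb) ntb (r := r)).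
rewrite -index_cent1; apply: pnat_dvd rXB; apply: indexgS.
by rewrite subsetI sBX sub_cent1 (subsetP abB).
Qed.

(** For [N] maximal normal in [M], minimality makes the intersection of its [X]-conjugates trivial,
    so a conjugate of [y] survives in the simple group [M / N] and makes it abelian. Then the
    derived subgroup of [M] is proper and normalised by [X], hence trivial. *)
Lemma minnormal_class_pnat gT (X M : {group gT}) (r : nat) y :
    minnormal M X -> M \subset X -> y \in M -> y != 1 ->
    r.-nat #|M : 'C_M[y]| -> abelian M.
Proof.
case/mingroupP=> /andP[ntM nMX] minM sMX My nty rMy.
have [N maxN] := ex_maxnormal_ntrivg ntM.
have [/andP[ltNM nNM] _] := maxgroupP maxN; have sNM := proper_sub ltNM.
have core1 : gcore N X = 1.
  apply: contraTeq (ltNM) => ntC; rewrite properE sNM negbK.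
  rewrite -(minM [group of gcore N X]) ?gcore_sub //=.
    by rewrite ntC gcore_norm.
  exact: subset_trans (gcore_sub _ _) sNM.
have [g Xg nNy] : exists2 g, g \in X & y \notin N :^ g.
  apply/exists_inP; apply: contraR nty; rewrite negb_exists_in => /forall_inP ally.
  have : y \in gcore N X.
    by apply/bigcapP=> g /ally; rewrite negbK.
  by rewrite core1 inE.
pose z := y ^ g^-1; have nMg : g^-1 \in 'N(M) by rewrite groupV (subsetP nMX).
have Mz : z \in M by rewrite memJ_norm.
have nNz : z \notin N by rewrite -mem_conjg.
have rMz : r.-nat #|M : 'C_M[z]|.
  rewrite -(indexJg _ _ g^-1) in rMy; move: rMy.
  by rewrite conjIg (normP nMg) -cent1J.
have simQ : simple (M / N) by rewrite quotient_simple // /normal sNM.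
have abQ : abelian (M / N).
  have nNz' := subsetP nNM z Mz.
  apply: (simple_class_pnat simQ (mem_quotient N Mz) (r := r)).
    by apply: contra nNz => /eqP/coset_idr->.
  rewrite -index_cent1; have sCN : 'C_M[z] \subset 'N(N).
    exact: subset_trans (subsetIl _ _) nNM.
  apply: pnat_dvd (pnat_dvd (index_quotient (_ : M :&: 'C_M[z] \subset 'N(N))) rMz).
    apply: indexgS; rewrite subsetI quotientS ?subsetIl //=.
    by apply: subset_trans (quotient_cent1 _ _); rewrite quotientS ?subsetIr.
  by rewrite subIset ?nNM.
have sMN : M^`(1) \subset N by apply: der1_min.
have [M1|ntM1] := eqVneq M^`(1) 1; first by rewrite derg1 in M1; apply/commG1P.
case/negP: (proper_subn ltNM); apply: subset_trans sMN.
have M1M : M^`(1) = M.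
  by apply: (minM [group of M^`(1)]); rewrite /= ?der_sub // ntM1
     (char_norm_trans (der_char _ _) nMX).
by rewrite M1M.
Qed.

End PrimePowerIndex.

(** * Two centraliser orders *)

Section TwoSizes.

Variables (gT : finGroupType) (G : {group gT}).
Hypothesis anti : cent_antichain G.

Local Notation Z := 'Z(G).
Local Notation nc x := (x \in G :\: 'Z(G)).

Let nZG : G \subset 'N(Z). Proof. exact/normal_norm/center_normal. Qed.

(* Components [C_G(x)] with a tame [x] are conjugate as soon as they have the same
   order; otherwise [C_G(x) / Z] is an [r]-group with a nonabelian Sylow
   [r]-subgroup in [G] (lemma [wild_component]). *)
Definition tame x :=
  has (fun p => [exists P : {group gT}, p.-Sylow(G) P && abelian P])
      (primes #|'C_G[x] / Z|).

Lemma card_cent1_quo_eq x y : x \in G -> y \in G -> #|'C_G[x]| = #|'C_G[y]| ->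
  #|'C_G[x] / Z| = #|'C_G[y] / Z|.
Proof.
move=> Gx Gy; rewrite !card_cent1_quo // => /eqP.
by rewrite eqn_pmul2l ?cardG_gt0 // => /eqP.
Qed.

(** Both are centralisers of conjugates of one abelian Sylow subgroup [P]. *)
Lemma tame_conj x w : tame x -> nc x -> nc w -> #|'C_G[w]| = #|'C_G[x]| ->
  abelian 'C_G[w] /\ exists2 g, g \in G & 'C_G[w] = 'C_G[x] :^ g.
Proof.
case/hasP=> p + /existsP[P /andP[sylP abP]] ncx ncw eqC.
rewrite mem_primes => /and3P[pr_p _ p_dv].
have [g Gg [_ _ ->]] := abelian_Sylow_component anti sylP abP pr_p ncx p_dv.
have p_dvw : p %| #|'C_G[w] / Z|.
  by rewrite (card_cent1_quo_eq _ _ eqC) ?(nc_G ncx) ?(nc_G ncw).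
have [h Gh [abw _ Dw]] := abelian_Sylow_component anti sylP abP pr_p ncw p_dvw.
split; rewrite {}Dw // in abw *.
exists (g^-1 * h); first by rewrite groupM ?groupV.
by rewrite conjIg (conjGid (groupM _ Gh)) ?groupV // -centJ -conjsgM mulKVg.
Qed.

(** In the abelian case every prime dividing [#|'C_G[x] / Z|] has nonabelian Sylow subgroups in [G],
    and [component_nonabelian_Sylow] allows only one such prime. *)
Lemma wild_component x : nc x -> ~~ tame x ->
  exists r, exists2 R : {group gT}, prime r /\ r.-Sylow(G) R
    & ~~ abelian R /\ r.-group ('C_G[x] / Z).
Proof.
move=> ncx wildx; have Gx := nc_G ncx.
have nabS p (P : {group gT}) : prime p -> p %| #|'C_G[x] / Z| -> p.-Sylow(G) P ->
    ~~ abelian P.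
  move=> pr_p p_dv sylP; apply: contra wildx => abP; apply/hasP; exists p.
    by rewrite mem_primes pr_p p_dv cardG_gt0.
  by apply/existsP; exists P; rewrite sylP.
have ntC : 'C_G[x] / Z != 1.
  apply/trivgPn; exists (coset Z x); last exact: coset_center_neq1.
  by rewrite mem_quotient ?cent1_id.
have [abC | [p pr_p pC]] := cent1_dichotomy anti ncx; last first.
  have p_dv := pgroup_dvd pC ntC; have [P sylP] := Sylow_exists p G.
  by exists p; exists P; split=> //; apply: nabS p_dv sylP.
set c := #|'C_G[x] / Z| in nabS *; pose r := pdiv c.
have pr_r : prime r by rewrite pdiv_prime // cardG_gt1.
have r_dv : r %| c := pdiv_dvd c; have [R sylR] := Sylow_exists r G.
exists r; exists R => //; split; first exact: nabS sylR.
apply/pgroupP=> t pr_t t_dv; apply/negPn/negP=> ntr.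
have [T sylT] := Sylow_exists t G.
apply: (component_nonabelian_Sylow anti ncx abC pr_t pr_r ntr t_dv r_dv sylT sylR).
  exact: nabS sylT.
exact: nabS sylR.
Qed.

Lemma tame_Frobenius x y : nc x -> nc y -> #|'C_G[x]| != #|'C_G[y]| ->
    (forall w, nc w -> #|'C_G[w]| = #|'C_G[x]| \/ #|'C_G[w]| = #|'C_G[y]|) ->
    tame x -> tame y ->
  solvable (G / Z) /\ [Frobenius (G / Z)].
Proof.
move=> ncx ncy neqC sizes tamex tamey.
have [abx _] := tame_conj tamex ncx ncx (erefl _).
have [aby _] := tame_conj tamey ncy ncy (erefl _).
have abxZ : abelian ('C_G[x] / Z) := quotient_abelian _ abx.
have abyZ : abelian ('C_G[y] / Z) := quotient_abelian _ aby.
apply: (TI_partition abxZ abyZ (component_TI anti ncx abx) (component_TI anti ncy aby));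
  rewrite ?quotientS ?subsetIl //.
  apply/eqP; rewrite eqEsubset; apply/andP; split; apply/subsetP=> wb.
    case/setD1P=> ntw /morphimP[w nZw Gw Dw].
    have ncw : nc w by rewrite nc_coset // -[coset Z w]Dw.
    apply/setUP; rewrite Dw /=; have [eqw|eqw] := sizes w ncw; [left|right].
      by apply/mem_component_support => //; case: (tame_conj tamex ncx ncw eqw).
    by apply/mem_component_support => //; case: (tame_conj tamey ncy ncw eqw).
  by case/setUP=> /imset2P[v h /setD1P[ntv Cv] Gh ->];
     rewrite !inE conjg_eq1 ntv groupJ // (subsetP _ _ Cv) ?quotientS ?subsetIl.
apply/pred0P=> wb; apply/negP=> /andP[/= wx].
have Gwb : wb \in (G / Z)^#.
  case/imset2P: wx => v h /setD1P[ntv Cv] Gh ->.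
  by rewrite !inE conjg_eq1 ntv groupJ // (subsetP _ _ Cv) ?quotientS ?subsetIl.
case/setD1P: Gwb => ntw /morphimP[w nZw Gw Dw]; rewrite {wb}Dw /= in ntw wx *.
have ncw : nc w by rewrite nc_coset.
case/(mem_component_support anti ncx abx ncw): wx => g Gg Dx.
case/(mem_component_support anti ncy aby ncw)=> h Gh Dy.
by case/eqP: neqC; rewrite -(cardJg _ g) -Dx Dy cardJg.
Qed.

End TwoSizes.

(** The commutator is central, so its order divides both [#[w]] and [#[v]]. *)
Lemma coprime_commute_lift (gT : finGroupType) (G : {group gT}) (pi : nat_pred) w v :
    w \in G -> v \in G -> pi.-elt w -> pi^'.-elt v ->
    commute (coset 'Z(G) w) (coset 'Z(G) v) -> commute w v.
Proof.
move=> Gw Gv piw pi'v cwv; have nZG := normal_norm (center_normal G).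
have [nZw nZv] := (subsetP nZG w Gw, subsetP nZG v Gv).
have Zwv : [~ w, v] \in 'Z(G).
  by apply: coset_idr; rewrite ?groupR // morphR //=; apply/eqP/commgP.
have cZ y : y \in G -> commute [~ w, v] y.
  by case/setIP: Zwv => _ /centP; apply.
have ow : [~ w, v] ^+ #[w] = 1.
  apply: (mulgI (w ^+ #[w])); rewrite -expgMn; last exact/commute_sym/cZ.
  by rewrite -conjg_mulR -conjXg !expg_order conj1g mulg1.
have ov : [~ w, v] ^+ #[v] = 1.
  rewrite -invg_comm expgVn; apply: invg_inj; rewrite invgK invg1.
  apply: (mulgI (v ^+ #[v])); rewrite -expgMn.
    by rewrite -conjg_mulR -conjXg !expg_order conj1g mulg1.
  by apply/commute_sym; rewrite -invg_comm; apply/commute_sym/commuteV/commute_sym/cZ.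
apply/commgP; rewrite -order_eq1 -dvdn1 -(eqP (pnat_coprime piw pi'v)).
by rewrite dvdn_gcd !order_dvdn ow ov eqxx.
Qed.

(** * Solvability of [G / Z] when some centraliser is untame *)

Section Wild.

Variables (gT : finGroupType) (G : {group gT}).
Hypothesis anti : cent_antichain G.

Local Notation Z := 'Z(G).
Local Notation nc x := (x \in G :\: 'Z(G)).

Let nZG : G \subset 'N(Z). Proof. exact/normal_norm/center_normal. Qed.

Lemma nonabelian_plane_fixpoint s (S : {group gT}) (M : {group coset_of Z}) :
    prime s -> s.-group S -> S \subset G -> ~~ abelian S ->
    abelian M -> S / Z \subset 'N(M) -> M :!=: 1 -> coprime #|M| s ->
  exists x m, [/\ x \in G / Z, #[x] = s, m \in M, m != 1 & commute x m].
Proof.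
move=> pr_s sS sSG nabS abM nMS ntM coMs.
have [e [f [[Se Sf cef oe of_] nfe]]] := nonabelian_pgroup_plane anti pr_s sS sSG nabS.
have pr_e : prime #[e] by rewrite oe.
have ofe : #[f] = #[e] by rewrite oe.
have coMe : coprime #|M| #[e] by rewrite oe.
have [x [Sx ox]] := plane_fixpoint abM nMS Se Sf cef pr_e ofe nfe ntM coMe.
case/trivgPn=> m /setIP[Mm cxm] ntm; exists x, m; split=> //.
- by rewrite (subsetP (quotientS _ sSG)).
- by rewrite ox.
by apply/commute_sym/cent1P.
Qed.

Variables (r : nat) (R : {group gT}) (b : gT).
Hypotheses (pr_r : prime r) (sylR : r.-Sylow(G) R) (nabR : ~~ abelian R).
Hypotheses (ncb : nc b) (nrb : ~~ r.-group ('C_G[b] / Z)).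
Hypothesis sizes : forall w, nc w ->
  r.-group ('C_G[w] / Z) \/ #|'C_G[w]| = #|'C_G[b]|.

Lemma nc_r'elt_card (t : nat) w : nc w -> t.-elt w -> t != r -> #|'C_G[w]| = #|'C_G[b]|.
Proof.
move=> ncw tw neq_tr; case: (sizes ncw) => // rC; case/eqP: neq_tr.
apply: (pelt_uniq (coset_center_neq1 ncw)) (cent1_quo_p ncw rC).
by rewrite morph_p_elt // (subsetP nZG) ?(nc_G ncw).
Qed.

Lemma commuting_r_r' w v : nc w -> nc v -> r.-elt w -> r^'.-elt v -> commute w v ->
  [/\ 'C_G[w] = 'C_G[v], abelian 'C_G[w], #|'C_G[w]| = #|'C_G[b]|
    & r %| #|'C_G[b] / Z|].
Proof.
move=> ncw ncv rw r'v cwv; have [Gw Gv] := (nc_G ncw, nc_G ncv).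
have Cwv : v \in 'C_G[w] by rewrite inE Gv; apply/cent1P/commute_sym.
have [Dwv abC] := cent1_coprime anti ncw ncv rw r'v Cwv.
have eqCb : #|'C_G[w]| = #|'C_G[b]|.
  case: (sizes ncw) => // rC; case/negP: (coset_center_neq1 ncv).
  have rv : r.-elt (coset Z v) by apply: mem_p_elt rC _; apply: mem_quotient.
  have r'v' : r^'.-elt (coset Z v) by rewrite morph_p_elt // (subsetP nZG).
  by rewrite -order_eq1 (pnat_1 rv r'v').
split=> //; rewrite -(card_cent1_quo_eq Gw (nc_G ncb) eqCb).
exact: nc_pelt_dvd (subsetIl _ _) pr_r (cent1_id Gw) ncw rw.
Qed.

Lemma wild_wild_solvable (q : nat) : q.-group ('C_G[b] / Z) -> solvable (G / Z).
Proof.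
move=> qC; apply: Burnside_p_a_q_b.
apply: (@uniq_leq_size _ _ [:: r; q] (primes_uniq _)) => p.
rewrite mem_primes => /and3P[pr_p _ p_dv]; rewrite !inE.
have [w Gw /andP[ncw pw]] := exists_nc_pelt (subxx G) pr_p p_dv.
have [//|neq_pr /=] := eqVneq p r.
have qCw : q.-group ('C_G[w] / Z).
  by rewrite /pgroup (card_cent1_quo_eq Gw (nc_G ncb) (nc_r'elt_card ncw pw neq_pr)).
apply/eqP; apply: (pelt_uniq (coset_center_neq1 ncw)) (cent1_quo_p ncw qCw).
by rewrite morph_p_elt // (subsetP nZG).
Qed.

Hypothesis tame_b : tame G b.

Let abB : abelian 'C_G[b]. Proof. by case: (tame_conj anti tame_b ncb ncb (erefl _)). Qed.

Let sBX : 'C_G[b] / Z \subset G / Z. Proof. by rewrite quotientS ?subsetIl. Qed.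

Lemma r'elt_support x : x \in G / Z -> x != 1 -> r^'.-elt x ->
  x \in class_support ('O_r^'('C_G[b] / Z))^# (G / Z).
Proof.
move=> Xx ntx r'x; have [w [Gw r'w] [nZw Dx]] := quotient_lift_elt Xx r'x.
have ncw : nc w by rewrite nc_coset // -Dx.
have eqC : #|'C_G[w]| = #|'C_G[b]|.
  case: (sizes ncw) => // rC; case/eqP: ntx; apply/eqP.
  have rx : r.-elt x by rewrite Dx cent1_quo_p.
  by rewrite -order_eq1 (pnat_1 rx r'x).
have [abw [g Gg Dw]] := tame_conj anti tame_b ncb ncw eqC.
have : x \in class_support ('C_G[b] / Z)^# (G / Z).
  by rewrite Dx; apply/mem_component_support => //; exists g.
case/imset2P=> y h /setD1P[nty By] Xh Dxy; rewrite Dxy memJ_class_support //.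
rewrite !inE nty mem_pcore_abelian ?quotient_abelian //.
by rewrite Dxy p_eltJ in r'x.
Qed.

(* The solutions of [x ^+ n = 1], with [n] the [r']-part of [#|G / Z|], are [1] and
   the nontrivial elements of the conjugates of the TI subgroup ['O_r^'(B)], hence
   [n] divides their number [1 + #|X : N| * _] by Frobenius's theorem. *)
Lemma index_norm_r : r.-nat #|G / Z : 'N_(G / Z)('C_G[b] / Z)|.
Proof.
set X := G / Z; set B := 'C_G[b] / Z; set N := 'N_X(B); pose C := 'O_r^'(B).
have ntC : C^# != set0.
  rewrite setD_eq0 subG1; apply: contra nrb => /eqP C1.
  apply: pgroup_elt => x Bx; rewrite -p_eltNK; apply/constt1P/eqP.
  by rewrite -in_set1 -[[set 1]]C1 mem_pcore_abelian ?quotient_abelian ?groupX ?p_elt_constt.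
have tiC : normedTI C^# X N.
  apply: normedTI_S (component_TI anti ncb abB) => //.
    by rewrite normD1 (char_norm_trans (pcore_char _ _)) ?subsetIr.
  by rewrite setSD ?pcore_sub.
apply/pnatP=> // s pr_s s_dv; apply/negPn/negP=> neq_sr.
set n := (#|X|`_r^')%N.
have : n %| #|'Ldiv_n(X)| by apply: Frobenius_Ldiv; apply: dvdn_part.
have -> : 'Ldiv_n(X) = 1 |: class_support C^# X.
  apply/setP=> x; apply/LdivP/setU1P=> [[Xx xn1]|].
    have [->|ntx] := eqVneq x 1; [by left | right].
    apply: r'elt_support => //; apply: pnat_dvd (part_pnat r^' #|X|).
    by rewrite order_dvdn xn1.
  case=> [->|/imset2P[y h /setD1P[_ Cy] Xh ->]]; first by rewrite expg1n group1.
  have Xy : y \in X by rewrite (subsetP sBX) // (subsetP (pcore_sub _ _) y Cy).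
  split; first exact: groupJ.
  rewrite -conjXg; apply/eqP; rewrite conjg_eq1 -order_dvdn.
  have r'y : r^'.-elt y := mem_p_elt (pcore_pgroup _ _) Cy.
  by rewrite -(part_pnat_id r'y) partn_dvd ?cardG_gt0 ?order_dvdG.
rewrite cardsU1 (card_support_normedTI tiC).
have s_dvX : s %| #|X| := dvdn_trans s_dv (dvdn_indexg _ _).
have s_dvn : s %| n.
  by rewrite -(part_pnat_id (_ : r^'.-nat s)) ?pnatE // partn_dvd ?cardG_gt0.
(* [s] divides both [n] and the index, so it would divide the remaining [1]. *)
move/(dvdn_trans s_dvn); rewrite dvdn_addl ?dvdn_mull //.
suff -> : 1 \notin class_support C^# X by rewrite dvdn1; case: eqP pr_s => // ->.
apply/imset2P=> [[y h /setD1P[nty _] _ /esym/eqP]].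
by rewrite conjg_eq1 (negPf nty).
Qed.

Lemma r'prime_dvd t : prime t -> t != r -> t %| #|G / Z| -> t %| #|'C_G[b] / Z|.
Proof.
move=> pr_t neq_tr t_dv; have [w Gw /andP[ncw tw]] := exists_nc_pelt (subxx G) pr_t t_dv.
rewrite -(card_cent1_quo_eq Gw (nc_G ncb) (nc_r'elt_card ncw tw neq_tr)).
exact: nc_pelt_dvd (subsetIl _ _) pr_t (cent1_id Gw) ncw tw.
Qed.

Lemma abelian_Sylow_index t (T : {group gT}) : prime t -> t != r ->
  t.-Sylow(G) T -> abelian T -> ~~ (t %| #|G / Z : 'C_G[b] / Z|).
Proof.
move=> pr_t neq_tr sylT abT; apply/negP=> t_dv.
have t_dvB : t %| #|'C_G[b] / Z|.
  by apply: r'prime_dvd => //; apply: dvdn_trans t_dv (dvdn_indexg _ _).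
have [g Gg [_ sTB _]] := abelian_Sylow_component anti sylT abT pr_t ncb t_dvB.
have sylTg : t.-Sylow(G) (T :^ g) by rewrite pHallJ.
have [_ _ t'i] := and3P sylTg.
have nZB : G :&: 'C_G[b] \subset 'N(Z) by rewrite subIset ?nZG.
have : t^'.-nat t.
  apply: pnat_dvd t'i; apply: dvdn_trans (indexgS G sTB).
  exact: dvdn_trans t_dv (index_quotient nZB).
by rewrite pnatE // !inE eqxx.
Qed.

(* A minimal normal [M] of [G / Z] cannot be abelian: [R] or [S] contains a plane of
   order [r ^ 2] or [s ^ 2] modulo [Z], one of whose elements fixes a point of [M].
   Otherwise some [y] in [M] has an [r]-power number of conjugates, contradicting
   [minnormal_class_pnat]. *)
Lemma second_nonabelian_Sylow s (S : {group gT}) :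
  prime s -> s != r -> s %| #|'C_G[b] / Z| -> s.-Sylow(G) S -> ~~ abelian S -> False.
Proof.
move=> pr_s neq_sr s_dv sylS nabS.
have Bs t (T : {group gT}) : prime t -> t != s -> t %| #|'C_G[b] / Z| ->
    t.-Sylow(G) T -> abelian T.
  move=> pr_t neq_ts t_dv sylT; apply: contraT => nabT.
  by case: (component_nonabelian_Sylow anti ncb abB pr_t pr_s neq_ts t_dv s_dv sylT sylS).
have no_r : ~~ (r %| #|'C_G[b] / Z|).
  apply: contra nabR => r_dv; apply: Bs r_dv sylR => //; by rewrite eq_sym.
have ncomm x m : x \in G / Z -> m \in G / Z -> r.-elt x -> r^'.-elt m ->
    x != 1 -> m != 1 -> ~ commute x m.
  move=> Xx Xm rx r'm ntx ntm; have [w [Gw rw] [nZw Dw]] := quotient_lift_elt Xx rx.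
  have [v [Gv r'v] [nZv Dv]] := quotient_lift_elt Xm r'm.
  rewrite Dw Dv => /(coprime_commute_lift Gw Gv rw r'v) cwv.
  have ncw : nc w by rewrite nc_coset // -Dw.
  have ncv : nc v by rewrite nc_coset // -Dv.
  by case/negP: no_r; case: (commuting_r_r' ncw ncv rw r'v cwv).
have ntX : G / Z != 1.
  by apply/trivgPn; exists (coset Z b); rewrite ?mem_quotient ?(nc_G ncb) ?coset_center_neq1.
have [M minM sMX] := minnormal_exists ntX (normG (G / Z)).
have [/andP[ntM nMX] _] := mingroupP minM.
have pelt_of (p : nat) (y : coset_of Z) : prime p -> #[y] = p -> p.-elt y.
  by move=> pr_p oy; rewrite /p_elt oy pnat_id.
have r'elt_of (p : nat) (y : coset_of Z) : p != r -> p.-elt y -> r^'.-elt y.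
  by move=> neq_pr; apply: sub_in_pnat => q _ /eqnP->.
have fixp (p q : nat) (T : {group gT}) : prime p -> prime q -> q != p -> q.-Sylow(G) T ->
    ~~ abelian T -> abelian M -> p.-group M ->
    exists x m, [/\ x \in G / Z, #[x] = q, m \in M, m != 1 & commute x m].
  move=> pr_p pr_q neq_qp sylT nabT abM pM; have sTG := pHall_sub sylT.
  apply: (nonabelian_plane_fixpoint pr_q (pHall_pgroup sylT) sTG nabT abM _ ntM).
    by apply: subset_trans nMX; apply: quotientS.
  by apply: pnat_coprime pM _; rewrite pnatE.
have nabM : ~~ abelian M.
  apply/negP=> abM; have solM := abelian_sol abM.
  have [_ _ /is_abelemP[p pr_p /and3P[pM _ _]]] := minnormal_solvable minM (subxx _) solM.
  have [eq_pr | neq_pr] := eqVneq p r.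
    rewrite eq_pr in pM.
    have [x [m [Xx ox Mm ntm cxm]]] := fixp r s S pr_r pr_s neq_sr sylS nabS abM pM.
    have r'x := r'elt_of s x neq_sr (pelt_of s x pr_s ox).
    apply: (ncomm m x (subsetP sMX m Mm) Xx (mem_p_elt pM Mm) r'x ntm _ (commute_sym cxm)).
    by rewrite -order_gt1 ox prime_gt1.
  have neq_rp : r != p by rewrite eq_sym.
  have [x [m [Xx ox Mm ntm cxm]]] := fixp p r R pr_p pr_r neq_rp sylR nabR abM pM.
  have r'm := r'elt_of p m neq_pr (mem_p_elt pM Mm).
  apply: (ncomm x m Xx (subsetP sMX m Mm) (pelt_of r x pr_r ox) r'm _ ntm cxm).
  by rewrite -order_gt1 ox prime_gt1.
have class_r y : y \in M -> y != 1 -> ~ r.-nat #|M : 'C_M[y]|.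
  by move=> My nty rMy; case/negP: nabM; apply: minnormal_class_pnat minM sMX My nty rMy.
have MB_of (t : nat) : prime t -> t != r -> t %| #|M| ->
    exists2 y, y \in M & y \in 'C_G[b] / Z /\ #[y] = t.
  move=> pr_t neq_tr t_dv; have [y My oy] := Cauchy pr_t t_dv.
  have nty : y != 1 by rewrite -order_gt1 oy prime_gt1.
  have r'y := r'elt_of t y neq_tr (pelt_of t y pr_t oy).
  have Xy := subsetP sMX y My.
  case/imset2P: (r'elt_support Xy nty r'y) => z h /setD1P[_ Oz] Xh Dy.
  exists z; first by rewrite -(memJ_norm _ (subsetP nMX h Xh)) -Dy.
  by rewrite -oy Dy orderJ (subsetP (pcore_sub _ _) z Oz).
set B := ('C_G[b] / Z)%G in MB_of *; set X := (G / Z)%G in MB_of *.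
have abBb : abelian B by apply: quotient_abelian.
have nsMX : M <| X by apply/andP.
have idxMX y : #|M : 'C_M[y]| %| #|X : 'C_X[y]|.
  have -> : 'C_M[y] = M :&: 'C_X[y] by rewrite setIA (setIidPl sMX).
  by rewrite indexgI normal_index_dvd ?subsetIl.
have idx_s y u : y \in B -> prime u -> u %| #|X : 'C_X[y]| -> u != r -> u = s.
  move=> By pr_u u_dv neq_ur; apply/eqP; apply: contraT => neq_us.
  have [T sylT] := Sylow_exists u G.
  have u_dvB : u %| #|B|.
    by apply: r'prime_dvd => //; apply: dvdn_trans u_dv (dvdn_indexg _ _).
  case/negP: (abelian_Sylow_index pr_u neq_ur sylT (Bs u T pr_u neq_us u_dvB sylT)).
  apply: dvdn_trans u_dv (indexgS _ _).
  by rewrite subsetI sBX sub_cent1 (subsetP abBb).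
(* By [idx_s] only [r] and [s] can divide the class size of an element of [B]. If [s] divides
   [#|M|], a suitable [y] is central in a Sylow [s]-subgroup of [N]; as [#|X : N|] is an [r]-power,
   this excludes [s]. *)
have [s_dvM | ns_dvM] := boolP (s %| #|M|).
  have [y0 My0 [By0 oy0]] := MB_of s pr_s neq_sr s_dvM.
  set N := 'N_X(B)%G; have [S1 sylS1] := Sylow_exists s N.
  pose K := (M :&: 'O_s(B))%G.
  have sBN : B \subset N by rewrite subsetI sBX normG.
  have nsKN : K <| N.
    rewrite /normal (subset_trans (subsetIr _ _)) ?(subset_trans (pcore_sub _ _)) //=.
    rewrite normsI ?(char_norm_trans (pcore_char _ _)) ?subsetIr //.
    exact: subset_trans (subsetIl _ _) nMX.
  have sK : s.-group K by apply: pgroupS (pcore_pgroup s B); apply: subsetIr.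
  have sKS1 : K \subset S1 := normal_sub_max_pgroup (Hall_max sylS1) sK nsKN.
  have nsKS1 : K <| S1 := normalS sKS1 (pHall_sub sylS1) nsKN.
  have ntK : K :!=: 1.
    apply/trivgPn; exists y0; last by rewrite -order_gt1 oy0 prime_gt1.
    by rewrite inE My0 mem_pcore_abelian ?(pelt_of s).
  have := meet_center_nil (pgroup_nil (pHall_pgroup sylS1)) nsKS1 ntK.
  case/trivgPn=> y /setIP[/setIP[My Oy] /setIP[S1y cS1y]] nty.
  have By := subsetP (pcore_sub _ _) y Oy.
  apply: (class_r y My nty); apply: pnat_dvd (idxMX y) _.
  apply/pnatP=> // u pr_u u_dv; apply/negPn/negP=> neq_ur.
  have Du := idx_s y u By pr_u u_dv neq_ur.
  have sNX : N \subset X := subsetIl _ _.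
  have : u %| #|X : N| * #|N : S1|.
    rewrite Lagrange_index ?(pHall_sub sylS1) //; apply: dvdn_trans u_dv (indexgS _ _).
    by rewrite subsetI (subset_trans (pHall_sub sylS1)) //= sub_cent1.
  rewrite Euclid_dvdM //; case/orP=> [/pnat_dvd/(_ index_norm_r)|].
    by rewrite pnatE // (negPf neq_ur).
  have [_ _ s'i] := and3P sylS1; move/pnat_dvd/(_ s'i).
  by rewrite pnatE // Du !inE eqxx.
(* Now [s] does not divide [#|M|], so an element of [M :&: B] of prime order other than [r] would
   have an [r]-power class size in [M]. *)
suff rM : r.-group M.
  have [_ _ /is_abelemP[p _ /and3P[_ abM _]]] :=
     minnormal_solvable minM (subxx _) (pgroup_sol rM).
  by case/negP: nabM.
apply/pgroupP=> t pr_t t_dv; apply/negPn/negP=> neq_tr.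
have [y My [By oy]] := MB_of t pr_t neq_tr t_dv.
apply: (class_r y My); first by rewrite -order_gt1 oy prime_gt1.
apply/pnatP=> // u pr_u u_dv; apply/negPn/negP=> neq_ur.
case/negP: ns_dvM; rewrite -(idx_s y u By pr_u (dvdn_trans u_dv (idxMX y)) neq_ur).
exact: dvdn_trans u_dv (dvdn_indexg _ _).
Qed.

Lemma wild_tame_solvable : solvable (G / Z).
Proof.
apply: (@solvable_abelian_index _ _ ('C_G[b] / Z)%G r) => //.
  exact: quotient_abelian.
apply/pnatP=> // t pr_t t_dv; apply/negPn/negP=> neq_tr.
have [T sylT] := Sylow_exists t G; have t_dvB : t %| #|'C_G[b] / Z|.
  by apply: r'prime_dvd => //; apply: dvdn_trans t_dv (dvdn_indexg _ _).
have [abT | nabT] := boolP (abelian T).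
  by case/negP: (abelian_Sylow_index pr_t neq_tr sylT abT).
exact: second_nonabelian_Sylow pr_t neq_tr t_dvB sylT nabT.
Qed.

End Wild.

Section NormMul.

Variables (gT : finGroupType) (M : {group gT}) (e : gT) (r : nat).
Hypotheses (abM : abelian M) (nMe : e \in 'N(M)) (er1 : e ^+ r = 1).

(** Reading the power as a norm makes it multiplicative in [k]. *)
Let norm_fmval k : k \in M ->
  (k * e) ^+ r = fmval (\sum_(0 <= i < r) (fmod abM k) ^@ (e^-1 ^+ i))%R.
Proof.
move=> Mk; rewrite fmval_norm ?groupV // fmodK // invgK expgVn er1 invg1.
by rewrite mulg1.
Qed.

Lemma norm_mem k : k \in M -> (k * e) ^+ r \in M.
Proof. by move=> Mk; rewrite norm_fmval // fmodP. Qed.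

Lemma norm_mul : {in M &, forall k1 k2,
  (k1 * k2 * e) ^+ r = (k1 * e) ^+ r * (k2 * e) ^+ r}.
Proof.
move=> k1 k2 Mk1 Mk2; rewrite !norm_fmval ?groupM // -fmvalA -big_split /=.
by congr fmval; apply: eq_bigr => i _; rewrite fmodM // actAr.
Qed.

Lemma norm_cent1 k : k \in M -> (k * e) ^+ r \in 'C_M[e].
Proof.
move=> Mk; rewrite inE norm_mem //; apply/cent1P.
have cwm : commute ((k * e) ^+ r) k by apply: (centsP abM) => //; apply: norm_mem.
have cww : commute ((k * e) ^+ r) (k * e) by apply/commute_sym/commuteX.
by have := commuteM (commuteV cwm) cww; rewrite mulKg.
Qed.

End NormMul.

(** * The Frobenius structure in the wild case *)

Section WildFrobenius.

Variables (gT : finGroupType) (G : {group gT}).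
Hypothesis anti : cent_antichain G.

Local Notation Z := 'Z(G).
Local Notation nc x := (x \in G :\: 'Z(G)).

Let nZG : G \subset 'N(Z). Proof. exact/normal_norm/center_normal. Qed.

Variables (r : nat) (R : {group gT}) (a b : gT).
Hypotheses (pr_r : prime r) (sylR : r.-Sylow(G) R) (nabR : ~~ abelian R).
Hypotheses (nca : nc a) (rCa : r.-group ('C_G[a] / Z)).
Hypotheses (ncb : nc b) (nrb : ~~ r.-group ('C_G[b] / Z)).
Hypothesis sizes : forall w, nc w ->
  r.-group ('C_G[w] / Z) \/ #|'C_G[w]| = #|'C_G[b]|.

(** With [D = 'C_G[x]] normal, [component_Sylow] gives [G / D] a Sylow [r]-subgroup of order [r].
    The [r]-group ['C_G[a] / Z] embeds in [G / D], since ['C_G[a]] meets [D] in [Z]; so its order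
    divides [r], hence [#|D / Z|], and the antichain condition makes [D / Z] an [r]-group. *)
Lemma normal_component_false x : nc x -> abelian 'C_G[x] -> G \subset 'N('C_G[x]) ->
  r %| #|'C_G[x] / Z| -> ~~ r.-group ('C_G[x] / Z) -> False.
Proof.
move=> ncx abD nDG r_dv nrD; have [q pr_q [neq_qr q_dv]] := not_pgroup_prime nrD.
have [H [sylH oH _]] := component_Sylow anti ncx abD pr_r pr_q neq_qr sylR nabR r_dv q_dv.
have Ga := nc_G nca; pose A := 'C_G[a].
have sAN : A \subset 'N('C_G[x]) by apply: subset_trans nDG; apply: subsetIl.
have AD_Z : A :&: 'C_G[x] = Z.
  apply/eqP; rewrite eqEsubset subsetI !center_sub_cent1 ?(nc_G ncx) // !andbT.
  apply/subsetP=> w /setIP[Aw Dw]; apply: contraR nrD => nZw.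
  have ncw : nc w by rewrite in_setD nZw; case/setIP: Aw.
  have Dwa : 'C_G[w] = 'C_G[x] by apply: component_cent1.
  have aD : a \in 'C_G[x] by rewrite -Dwa cent1_sym.
  by rewrite -(component_cent1 anti ncx abD aD nca).
have oA : #|A / 'C_G[x]| = #|A / Z|.
  rewrite !card_quotient //; first by rewrite -indexgI AD_Z.
  by apply: subset_trans nZG; apply: subsetIl.
have: #|A / Z| %| r.
  rewrite -oH (card_Hall sylH) -oA.
  have rAD : r.-group (A / 'C_G[x]) by rewrite /pgroup oA.
  rewrite -(part_pnat_id rAD) partn_dvd ?cardG_gt0 //; apply: cardSg.
  apply: quotientS; rewrite subsetI subsetIl; exact: sAN.
move=> A_r; have: #|A| = #|'C_G[x]|.
  apply: anti => //; rewrite !card_cent1_quo ?(nc_G ncx) // dvdn_pmul2l ?cardG_gt0 //.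
  exact: dvdn_trans A_r r_dv.
move/card_cent1_quo_eq => eqAx; case/negP: nrD.
by rewrite /pgroup -eqAx ?(nc_G ncx).
Qed.

(** It suffices that [M] centralises [y], for then ['C_G[x] = 'C_G(M)]. A [p]-element [m] of [M]
    moves [x] by a central factor, so it normalises ['C_G[x]]; thus [[~ y, m]] lies in [M] and in
    the abelian ['C_G[x]], is a [p']-element, and is central. *)
Lemma normal_abelian_commute (p : nat) (M : {group gT}) x y :
    M <| G -> abelian (M / Z) -> p.-group (M / Z) ->
    x \in M -> nc x -> p.-elt x -> nc y -> p^'.-elt y -> commute x y ->
  [/\ 'C_G[x] = 'C_G[y], abelian 'C_G[x] & G \subset 'N('C_G[x])].
Proof.
move=> nsMG abM pM Mx ncx px ncy p'y cxy; have [sMG nMG] := andP nsMG.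
have [Gx Gy] := (nc_G ncx, nc_G ncy).
have Cxy : y \in 'C_G[x] by rewrite inE Gy; apply/cent1P/commute_sym.
have [Dxy abC] := cent1_coprime anti ncx ncy px p'y Cxy.
have nZM := subset_trans sMG nZG.
have Z_of_p' m : m \in M -> p^'.-elt m -> m \in Z.
  move=> Mm p'm; apply: coset_idr; first by rewrite (subsetP nZM).
  apply/eqP; rewrite -order_eq1; apply/eqP.
  apply: (@pnat_1 p); first by apply: mem_p_elt pM _; apply: mem_quotient.
  by apply: morph_p_elt p'm; rewrite (subsetP nZM).
have sMC : M \subset 'C_G[y].
  have cym m : m \in M -> p.-elt m -> m \in 'C_G[y].
    move=> Mm pm; have Gm := subsetP sMG m Mm.
    have [nZx nZm] := (subsetP nZG x Gx, subsetP nZG m Gm).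
    have Zxm : [~ x, m] \in Z.
      apply: coset_idr; rewrite ?groupR // morphR //=; apply/eqP/commgP.
      by apply: (centsP abM); apply: mem_quotient.
    have DCm : 'C_G[x] :^ m = 'C_G[x].
      rewrite -cent1_subgJ // conjg_mulR -(cent1_centerM x Zxm); congr 'C_G[_].
      by case/setIP: Zxm => _ /centP/(_ x Gx).
    have Ck : [~ y, m] \in 'C_G[x].
      have Cym : y ^ m \in 'C_G[x] by rewrite -DCm memJ_conjg.
      by rewrite commgEl groupM ?groupV.
    have Mk : [~ y, m] \in M.
      by rewrite commgEr groupM // memJ_norm ?groupV // (subsetP nMG).
    have p'k : p^'.-elt [~ y, m].
      apply: pnat_dvd p'y; rewrite order_dvdn.
      have cyk : commute y [~ y, m] by apply: (centsP abC).
      apply/eqP; apply: (mulgI (y ^+ #[y])).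
      by rewrite -expgMn // -conjg_mulR -conjXg !expg_order conj1g mulg1.
    have Zk := Z_of_p' _ Mk p'k; rewrite inE Gm; apply/cent1P.
    apply: (coprime_commute_lift Gm Gy pm p'y); apply/commute_sym/commgP/eqP.
    by rewrite -morphR ?(subsetP nZG) //= coset_id.
  apply/subsetP=> m Mm; rewrite -(consttC p m) groupM //.
    by rewrite cym ?groupX ?p_elt_constt.
  apply: (subsetP (center_sub_cent1 Gy)).
  by rewrite Z_of_p' ?groupX ?p_elt_constt.
split=> //; suff -> : 'C_G[x] = 'C_G(M) by rewrite normsI ?normG ?norms_cent.
apply/eqP; rewrite eqEsubset subsetI subsetIl centsC /=; apply/andP; split.
  by rewrite -Dxy in sMC; apply: subset_trans sMC abC.
by rewrite setIS // -cent_cycle centS // cycle_subG.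
Qed.

Lemma nc_r'elt_not_rgroup x v : v \in 'C_G[x] -> nc v -> r^'.-elt v ->
  ~~ r.-group ('C_G[x] / Z).
Proof.
move=> Cv ncv r'v; apply/negP=> rC; case/negP: (coset_center_neq1 ncv).
have rv : r.-elt (coset Z v) by apply: mem_p_elt rC _; apply: mem_quotient.
have r'v' : r^'.-elt (coset Z v).
  by apply: morph_p_elt r'v; rewrite (subsetP nZG) ?(nc_G ncv).
by rewrite -order_eq1 (pnat_1 rv r'v').
Qed.

(** In both cases [m] and [y] lift to commuting elements of coprime orders, one of them an
    [r]-element; their common centraliser is abelian and normal, which [normal_component_false]
    forbids. *)
Lemma normal_abelian_false (p : nat) (M : {group coset_of Z}) m y :
    M <| G / Z -> abelian M -> p.-group M -> m \in M -> m != 1 ->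
    y \in G / Z -> y != 1 -> commute m y ->
    p = r /\ r^'.-elt y \/ p != r /\ r.-elt y -> False.
Proof.
move=> nsMX abM pM Mm ntm Xy nty cmy cases.
pose Mh := (coset Z @*^-1 M)%G; have MhZ : Mh / Z = M by apply: cosetpreK.
have nsMhG : Mh <| G.
  by rewrite -(quotientGK (center_normal G)) cosetpre_normal.
have [mh [Mmh pmh] [nZm Dm]] : exists2 x, x \in Mh /\ p.-elt x & x \in 'N(Z) /\ m = coset Z x.
  by apply: quotient_lift_elt; rewrite ?MhZ ?(mem_p_elt pM).
have Gmh : mh \in G := subsetP (normal_sub nsMhG) mh Mmh.
have ncm : nc mh by rewrite nc_coset // -Dm.
pose pi : nat_pred := if p == r then r^' else r.
have piy : pi.-elt y by rewrite /pi; case: cases => [[-> ?]|[/negPf-> ?]]; rewrite ?eqxx.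
have [yh [Gyh piyh] [nZy Dy]] := quotient_lift_elt Xy piy.
have ncy : nc yh by rewrite nc_coset // -Dy.
have p'y : p^'.-elt yh.
  move: piyh; rewrite /pi; have [-> //|neq_pr] := eqVneq p r.
  by apply: sub_in_pnat => q _ /eqnP->; rewrite !inE eq_sym.
have cmy' : commute mh yh by apply: (coprime_commute_lift Gmh Gyh pmh p'y); rewrite -Dm -Dy.
have abMh : abelian (Mh / Z) by rewrite MhZ.
have pMh : p.-group (Mh / Z) by rewrite MhZ.
have [Dmy abC nCG] := normal_abelian_commute nsMhG abMh pMh Mmh ncm pmh ncy p'y cmy'.
have Cy : yh \in 'C_G[mh] by rewrite Dmy cent1_id.
case: cases => [[eq_pr _]|[neq_pr _]].
  apply: (normal_component_false ncm abC nCG).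
    apply: (nc_pelt_dvd (subsetIl _ _) pr_r (cent1_id Gmh) ncm).
    by rewrite -eq_pr.
  by apply: nc_r'elt_not_rgroup Cy ncy _; rewrite -eq_pr.
apply: (normal_component_false ncm abC nCG).
  apply: (nc_pelt_dvd (subsetIl _ _) pr_r Cy ncy).
  by move: piyh; rewrite /pi (negPf neq_pr).
apply: nc_r'elt_not_rgroup (cent1_id Gmh) ncm _.
by apply: sub_in_pnat pmh => q _ /eqnP->.
Qed.

Hypothesis solX : solvable (G / Z).

Lemma normal_rgroup_regular (M : {group coset_of Z}) m y :
    M <| G / Z -> abelian M -> r.-group M -> m \in M -> m != 1 ->
    y \in G / Z -> y != 1 -> r^'.-elt y -> ~ commute m y.
Proof.
move=> nsMX abM rM Mm ntm Xy nty r'y cmy.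
by apply: (normal_abelian_false nsMX abM rM Mm ntm Xy nty cmy); left.
Qed.

(** On a minimal normal subgroup of order prime to [r], some element of order [r] in a plane of
    [R / Z] would have a fixed point, against [normal_abelian_false]. *)
Lemma exists_normal_rabelem : exists M : {group coset_of Z},
  [/\ M <| G / Z, r.-abelem M & M :!=: 1].
Proof.
have ntX : G / Z != 1.
  by apply/trivgPn; exists (coset Z b); rewrite ?mem_quotient ?(nc_G ncb) ?coset_center_neq1.
have [M minM sMX] := minnormal_exists ntX (normG (G / Z)).
have [/andP[ntM nMX] _] := mingroupP minM.
have nsMX : M <| G / Z by apply/andP.
have [_ _ /is_abelemP[p pr_p abelM]] := minnormal_solvable minM (subxx _) (solvableS sMX solX).
have [abM pM _] := and3P abelM; exists M; split=> //.
have [<- //|neq_pr] := eqVneq p r.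
have sRG := pHall_sub sylR; have rR := pHall_pgroup sylR.
have nMR : R / Z \subset 'N(M) by apply: subset_trans nMX; apply: quotientS.
have coMr : coprime #|M| r by apply: pnat_coprime abM _; rewrite pnatE // !inE eq_sym.
have [x [m [Xx ox Mm ntm cxm]]] :=
  nonabelian_plane_fixpoint anti pr_r rR sRG nabR pM nMR ntM coMr.
have ntx : x != 1 by rewrite -order_gt1 ox prime_gt1.
case: (normal_abelian_false nsMX pM abM Mm ntm Xx ntx (commute_sym cxm)).
by right; split=> //; rewrite /p_elt ox pnat_id.
Qed.

(* If [t] and [y] are commuting noncentral [r]- and [r']-elements and [m] in [M] is
   fixed by [t] modulo [Z], then [m ^ y] and [m] have the same effect on [t], so
   [m ^ y * m^-1] lies in [C_G(t) = C_G(y)], against [y] acting freely on [M]. *)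
Lemma r_ndvd_b : ~~ (r %| #|'C_G[b] / Z|).
Proof.
apply/negP=> r_dv; have [M [nsMX abelM ntM]] := exists_normal_rabelem.
have [rM abM _] := and3P abelM; have Gb := nc_G ncb.
have sBG : 'C_G[b] \subset G := subsetIl _ _.
have [q pr_q [neq_qr q_dv]] := not_pgroup_prime nrb.
have [t Bt /andP[nct rt]] := exists_nc_pelt sBG pr_r r_dv.
have [y By /andP[ncy qy]] := exists_nc_pelt sBG pr_q q_dv.
have [Gt Gy] := (nc_G nct, nc_G ncy).
have r'y : r^'.-elt y by apply: sub_in_pnat qy => u _ /eqnP->.
have abB : abelian 'C_G[b].
  have [//|[p pr_p pB]] := cent1_dichotomy anti ncb.
  have Dp (u : nat) w : w \in 'C_G[b] -> nc w -> u.-elt w -> p = u.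
    move=> Bw ncw uw; apply: (pelt_uniq (coset_center_neq1 ncw)).
      by apply: mem_p_elt pB _; apply: mem_quotient.
    by apply: morph_p_elt uw; rewrite (subsetP nZG) ?(nc_G ncw).
  by case/eqP: neq_qr; rewrite -(Dp q y) // -(Dp r t).
have cty : commute t y by apply: (centsP abB).
have [Dty _ _ _] := commuting_r_r' anti pr_r ncb sizes nct ncy rt r'y cty.
have [tb yb] := (mem_quotient Z Gt, mem_quotient Z Gy).
have ntyb := coset_center_neq1 ncy.
have r'yb : r^'.-elt (coset Z y) by apply: morph_p_elt r'y; rewrite (subsetP nZG).
(* [P] is an [r]-group, so its centre meets [M]; this provides the [m] fixed by [t]. *)
pose P := (M <*> <[coset Z t]>)%G.
have rP : r.-group P.
  rewrite /= norm_joinEr ?pgroupM ?rM; last first.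
    by rewrite cycle_subG (subsetP (normal_norm nsMX)).
  by rewrite [r.-group _]morph_p_elt // (subsetP nZG).
have nsMP : M <| P.
  rewrite /normal joing_subl join_subG normG cycle_subG.
  by rewrite (subsetP (normal_norm nsMX)).
have /trivgPn[m /setIP[Mm /setIP[_ cPm]] ntm] := meet_center_nil (pgroup_nil rP) nsMP ntM.
have Xm := subsetP (normal_sub nsMX) m Mm.
have [mh nZm Gm Dm] := morphimP Xm; rewrite /= in Dm.
have Ztm : [~ t, mh] \in Z.
  apply: coset_idr; rewrite ?groupR ?(subsetP nZG) // morphR ?(subsetP nZG) //=.
  rewrite -Dm; apply/eqP/commgP/commute_sym; apply: (centP cPm).
  by rewrite mem_gen // inE cycle_id orbT.
have ZJ g : g \in G -> [~ t, mh] ^ g = [~ t, mh].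
  by move=> Gg; apply/conjg_fixP/commgP; case/setIP: Ztm => _ /centP; apply.
pose k := mh ^ y * mh^-1; have Gk : k \in G by rewrite groupM ?groupJ ?groupV.
have tk : k \in 'C_G[t].
  rewrite inE Gk; apply/cent1P/commute_sym/commgP/conjg_fixP.
  have ty : t ^ y = t by apply/conjg_fixP/commgP.
  have tmy : t ^ (mh ^ y) = t ^ mh.
    by rewrite -[X in X ^ (mh ^ y)]ty -conjJg (conjg_mulR t mh) conjMg ZJ // ty.
  by rewrite conjgM tmy -conjgM mulgV conjg1.
rewrite Dty in tk; have cky : commute k y by case/setIP: tk => _ /cent1P.
have Dk : coset Z k = m ^ coset Z y * m^-1.
  by rewrite morphM ?groupJ ?groupV ?(subsetP nZG) //= morphJ ?morphV ?(subsetP nZG) //= -Dm.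
have Mk : coset Z k \in M.
  by rewrite Dk groupM ?groupV // memJ_norm // (subsetP (normal_norm nsMX)).
have ntk : coset Z k != 1.
  apply/eqP=> k1; apply: (normal_rgroup_regular nsMX abM rM Mm ntm yb ntyb r'yb).
  by apply/commgP/conjg_fixP; apply/eqP; rewrite eq_mulgV1 -Dk k1.
apply: (normal_rgroup_regular nsMX abM rM Mk ntk yb ntyb r'yb).
by rewrite /commute -!morphM ?(subsetP nZG) //= cky.
Qed.

Lemma r_r'_elts_not_commute x y : x \in G / Z -> x != 1 -> r.-elt x ->
  y \in G / Z -> y != 1 -> r^'.-elt y -> ~ commute x y.
Proof.
move=> Xx ntx rx Xy nty r'y; have [w [Gw rw] [nZw Dw]] := quotient_lift_elt Xx rx.
have [v [Gv r'v] [nZv Dv]] := quotient_lift_elt Xy r'y.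
rewrite Dw Dv => /(coprime_commute_lift Gw Gv rw r'v) cwv.
have ncw : nc w by rewrite nc_coset // -Dw.
have ncv : nc v by rewrite nc_coset // -Dv.
by case/negP: r_ndvd_b; case: (commuting_r_r' anti pr_r ncb sizes ncw ncv rw r'v cwv).
Qed.

Lemma relt_cent1_rgroup w : nc w -> r.-elt (coset Z w) -> r.-group ('C_G[w] / Z).
Proof.
move=> ncw rw; case: (sizes ncw) => // eqC; case/negP: r_ndvd_b.
have Gw := nc_G ncw; rewrite -(card_cent1_quo_eq Gw (nc_G ncb) eqC).
have r_dvw : r %| #|<[coset Z w]>|.
  by apply: pgroup_dvd => //; rewrite cycle_eq1 coset_center_neq1.
apply: dvdn_trans r_dvw (cardSg _); rewrite cycle_subG.
by rewrite mem_quotient ?cent1_id.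
Qed.

(* In [X = G / Z], take a [q]-subgroup [H] with ['O_r(X) * H <| X]; by a Frattini
   argument an element [e] of order [r] normalises [H], and [H ><| <[e]>] is a
   Frobenius group, to which the norm identity on [M] applies. *)
Lemma Sylow_nonnormal_norm (M : {group coset_of Z}) : ~~ (R / Z <| G / Z) ->
    M <| G / Z -> r.-abelem M -> M :!=: 1 ->
  exists e h, exists2 m, [/\ e \in G / Z, #[e] = r & m \in M] &
    [/\ (m * e) ^+ r != 1, h \in G / Z, [~ e, h] != 1 & r^'.-elt [~ e, h]].
Proof.
move=> nnR nsMX abelM ntM; have [rM abM _] := and3P abelM.
set X := (G / Z)%G in nsMX nnR *; have nMX := normal_norm nsMX.
have sylP : r.-Sylow(X) (R / Z).
  by apply: quotient_pHall sylR; apply: subset_trans nZG; apply: pHall_sub sylR.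
pose O := 'O_r(X)%G; have nsOX : O <| X := pcore_normal r X.
have ntY : X / O != 1.
  apply: contra nrb => /eqP/trivgP; rewrite quotient_sub1 ?normal_norm // => sXO.
  apply: pgroupS (pcore_pgroup r X); apply: subset_trans sXO.
  by rewrite quotientS ?subsetIl.
have [M1 minM1 sM1Y] := minnormal_exists ntY (normG (X / O)).
have [/andP[ntM1 nM1Y] _] := mingroupP minM1.
have nsM1Y : M1 <| X / O by apply/andP.
have solM1 := solvableS sM1Y (quotient_sol O solX).
have [_ _ /is_abelemP[q pr_q /and3P[qM1 _ _]]] := minnormal_solvable minM1 (subxx _) solM1.
have neq_qr : q != r.
  apply: contraNneq ntM1 => eq_qr; rewrite eq_qr in qM1.
  by rewrite -subG1 -(trivg_pcore_quotient r X) pcore_max.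
pose K := (coset O @*^-1 M1)%G; have KO : K / O = M1 by apply: cosetpreK.
have nsKX : K <| X by rewrite -(quotientGK nsOX) cosetpre_normal.
have [H sylH] := Sylow_exists q K; have [sHK qH _] := and3P sylH.
have sKX := normal_sub nsKX; have nOK := subset_trans sKX (normal_norm nsOX).
have HOM1 : H / O = M1.
  have sylHO : q.-Sylow(K / O) (H / O).
    by apply: quotient_pHall sylH; apply: subset_trans nOK.
  have qKO : q.-group (K / O) by rewrite KO.
  by rewrite -KO; apply: (pHall_id sylHO qKO).
have ntH : H :!=: 1.
  by apply: contraNneq ntM1 => H1; rewrite -HOM1 H1 quotient1.
have sKOH : K \subset O * H by rewrite -quotientSK // HOM1 KO.
pose N := 'N_X(H)%G.
have sHN : H \subset N by rewrite subsetI normG (subset_trans sHK).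
have XON : X \subset O * N.
  rewrite -(Frattini_arg nsKX sylH) (subset_trans (mulSg _ sKOH)) //.
  by rewrite -mulgA mulgS // mulSGid.
(* Otherwise [X = O * N] would make [O] a Sylow [r]-subgroup, so [R / Z = O] would be normal. *)
have r_dvN : r %| #|N|.
  apply: contraR nnR => r'N; suff -> : R / Z = O by [].
  apply/esym/eqP; rewrite eqEcard pcore_sub_Hall //= (card_Hall sylP).
  have dvX : #|X| %| #|O| * #|N|.
    have sONX : O * N \subset X by rewrite mul_subG ?subsetIl ?normal_sub.
    have <- : O * N = X by apply/eqP; rewrite eqEsubset sONX.
    by rewrite mul_cardG dvdn_mulr.
  have r'N' : r^'.-nat #|N| by rewrite p'natE.
  apply: leq_trans (dvdn_leq (part_gt0 _ _) (partn_dvd r _ dvX)) _.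
    by rewrite muln_gt0 !cardG_gt0.
  by rewrite partnM ?cardG_gt0 // (part_p'nat r'N') muln1 dvdn_leq ?dvdn_part.
have [e Ne oe] := Cauchy pr_r r_dvN; have [Xe nHe] := setIP Ne.
have r'H y : y \in H -> r^'.-elt y.
  by move=> Hy; apply: sub_in_pnat (mem_p_elt qH Hy) => u _ /eqnP->.
have sHX := subset_trans sHK sKX.
have relt (x : coset_of Z) : #[x] = r -> r.-elt x by move=> ox; rewrite /p_elt ox pnat_id.
have nt_r (x : coset_of Z) : #[x] = r -> x != 1 by move=> ox; rewrite -order_gt1 ox prime_gt1.
have regHe : 'C_H[e] = 1.
  apply/trivgP/subsetP=> y /setIP[Hy /cent1P cye]; rewrite inE; apply: contraT => nty.
  case: (r_r'_elts_not_commute Xe (nt_r e oe) (relt e oe) (subsetP sHX y Hy) nty (r'H y Hy)).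
  exact: commute_sym.
have regMH : 'C_M(H) = 1.
  have [y Hy nty] := trivgPn _ ntH.
  apply/trivgP/subsetP=> m /setIP[Mm /centP cmH]; rewrite inE; apply: contraT => ntm.
  case: (normal_rgroup_regular nsMX abM rM Mm ntm (subsetP sHX y Hy) nty (r'H y Hy)).
  exact: cmH.
have coMH : coprime #|M| #|H|.
  by apply: pnat_coprime rM (pgroup_elt _).
have pr_e : prime #[e] by rewrite oe.
have nMN : N \subset 'N(M) := subset_trans (subsetIl _ _) nMX.
have [x [m [Nx ox Mm] ntx]] :=
  Frobenius_norm_neq1 abM nMN sHN Ne nHe pr_e regHe regMH ntM coMH.
rewrite oe in ox ntx; have [y Hy nty] := trivgPn _ ntH.
have [Xx nHx] := setIP Nx.
have Hxy : [~ x, y] \in H by rewrite commgEr groupM // memJ_norm ?groupV.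
exists x, y, m; split=> //; first exact: subsetP sHX y Hy; last exact: r'H.
apply/commgP=> cxy.
exact: (r_r'_elts_not_commute Xx (nt_r x ox) (relt x ox) (subsetP sHX y Hy) nty (r'H y Hy)).
Qed.

(* Modulo [Z], [kh] commutes with [v = mh * eh]; as [kh ^+ r] is central, [kh]
   commutes with [v ^+ r], which has the same centraliser as [v]. *)
Lemma commute_norm_lift (M : {group coset_of Z}) (e m k : coset_of Z) eh mh kh :
    M <| G / Z -> r.-abelem M -> m \in M -> k \in 'C_M[e] ->
    eh \in G -> mh \in G -> kh \in G ->
    e = coset Z eh -> m = coset Z mh -> k = coset Z kh ->
    (m * e) ^+ r != 1 ->
  commute (mh * eh) kh /\ 'C_G[mh * eh] = 'C_G[(mh * eh) ^+ r].
Proof.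
move=> nsMX abelM Mm /setIP[Mk /cent1P cke] Geh Gmh Gkh De Dm Dk ntN.
have [_ abM expM] : [/\ r.-group M, abelian M & forall y, y \in M -> y ^+ r = 1].
  by case/(abelemP pr_r): (abelM) => ? ?; case/and3P: abelM.
set v := mh * eh; have Gv : v \in G by apply: groupM.
have Dv : coset Z v = m * e by rewrite Dm De morphM ?(subsetP nZG).
have ncvr : nc (v ^+ r).
  by rewrite nc_coset ?groupX // morphX ?(subsetP nZG) //= Dv.
have ncv : nc v.
  by rewrite nc_coset // Dv; apply: contraNneq ntN => ->; rewrite expg1n.
have Cvr := cent1_expg_eq anti ncv ncvr; split=> //.
suff : kh \in 'C_G[v] by case/setIP=> _ /cent1P/commute_sym.
have [nZk nZv] := (subsetP nZG kh Gkh, subsetP nZG v Gv).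
have Zkv : [~ kh, v] \in Z.
  apply: coset_idr; rewrite ?groupR // morphR //= Dv -Dk; apply/eqP/commgP.
  by apply: commuteM => //; apply: (centsP abM).
have ZJ c g : c \in Z -> g \in G -> c ^ g = c.
  by move=> /setIP[_ /centP cGc] Gg; apply/conjg_fixP/commgP; apply: cGc.
have cr1 : [~ kh, v] ^+ r = 1.
  have Zkr : kh ^+ r \in Z.
    by apply: coset_idr; rewrite ?groupX // morphX //= -Dk expM.
  apply: (mulgI (kh ^+ r)); rewrite -expgMn.
    by rewrite -conjg_mulR -conjXg ZJ // mulg1.
  by apply/commute_sym; case/setIP: Zkv => _ /centP; apply.
have kvi i : kh ^ (v ^+ i) = kh * [~ kh, v] ^+ i.
  elim: i => [|i IHi]; first by rewrite conjg1 mulg1.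
  rewrite expgSr conjgM IHi conjMg (ZJ ([~ kh, v] ^+ i)) ?groupX //.
  by rewrite conjg_mulR -mulgA -expgS.
rewrite Cvr inE Gkh; apply/cent1P/commgP/conjg_fixP.
by rewrite kvi cr1 mulg1.
Qed.

(* If the kernel of the norm of [e] had index more than [2] in [M], every [k] in [M]
   would be [(k * m1 * e) * (m1 * e)^-1] with both norms nontrivial, so its lifts
   would commute with [v ^+ r], hence with [v = mh * eh]; then [M] centralises
   [m * e] and [(m * e) ^+ r = 1]. *)
Lemma norm_kernel_card (M : {group coset_of Z}) e m :
    M <| G / Z -> r.-abelem M -> e \in G / Z -> #[e] = r -> m \in M ->
    (m * e) ^+ r != 1 ->
  #|M| <= 2 * #|[set k in M | (k * e) ^+ r == 1]|.
Proof.
move=> nsMX abelM Xe oe Mm ntN; set L := [set k in M | _].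
have [rM abM _] := and3P abelM; have [_ expM] := abelemP pr_r abelM.
have nMX := subsetP (normal_norm nsMX); have sMX := subsetP (normal_sub nsMX).
have [eh nZe Geh De] := morphimP Xe; rewrite /= in De.
have [mh nZm Gmh Dm] := morphimP (sMX m Mm); rewrite /= in Dm.
rewrite leqNgt; apply/negP=> ltLM; set v := mh * eh; set w := (m * e) ^+ r in ntN.
have er1 : e ^+ r = 1 by rewrite -oe expg_order.
have Cw : w \in 'C_M[e] := norm_cent1 abM (nMX e Xe) er1 Mm.
have exM k : k \in M -> exists2 m1, m1 \in M & (m1 * e) ^+ r != 1 /\ (k * m1 * e) ^+ r != 1.
  move=> Mk; have [/exists_inP[m1 Mm1 /andP[nt1 nt2]]|/exists_inPn none] :=
    boolP [exists m1 in M, ((m1 * e) ^+ r != 1) && ((k * m1 * e) ^+ r != 1)].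
    by exists m1.
  (* If no [m1] works, [L] and its translate by [k^-1] cover [M]. *)
  case/idPn: ltLM; rewrite -leqNgt mul2n -addnn -[X in _ <= _ + X](card_lcoset L k^-1).
  apply: leq_trans (leq_card_setU _ _); apply: subset_leq_card.
  apply/subsetP=> m1 Mm1; have := none m1 Mm1; rewrite negb_and !negbK.
  rewrite in_setU mem_lcoset invgK !inE Mm1 groupM //=.
have Gv : v \in G by apply: groupM.
have Dv : coset Z v = m * e by rewrite Dm De morphM ?(subsetP nZG).
have Gvr : v ^+ r \in G by apply: groupX.
have Dvr : w = coset Z (v ^+ r) by rewrite morphX ?(subsetP nZG) //= Dv.
have cvM k : k \in M -> commute (coset Z v) k.
  move=> Mk; have [m1 Mm1 [nt1 nt2]] := exM k Mk.
  have [kh nZk Gkh Dk] := morphimP (sMX k Mk); rewrite /= in Dk.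
  have [m1h nZm1 Gm1h Dm1] := morphimP (sMX m1 Mm1); rewrite /= in Dm1.
  have Mkm1 : k * m1 \in M by apply: groupM.
  have Dkm1 : k * m1 = coset Z (kh * m1h) by rewrite Dk Dm1 morphM.
  have [c1 _] := commute_norm_lift nsMX abelM Mm1 Cw Geh Gm1h Gvr De Dm1 Dvr nt1.
  have [c2 _] :=
    commute_norm_lift nsMX abelM Mkm1 Cw Geh (groupM Gkh Gm1h) Gvr De Dkm1 Dvr nt2.
  have [_ Cvr] := commute_norm_lift nsMX abelM Mm Cw Geh Gmh Gvr De Dm Dvr ntN.
  have ckw : commute (v ^+ r) kh.
    have := commuteM (commute_sym c2) (commuteV (commute_sym c1)).
    by rewrite -(mulgA kh) mulgK.
  have : kh \in 'C_G[v] by rewrite Cvr inE Gkh; apply/cent1P/commute_sym.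
  case/setIP=> _ /cent1P ckv; rewrite Dk /commute -!morphM ?(subsetP nZG) //=.
  by rewrite ckv.
case/eqP: ntN; rewrite /w expgMn; first by rewrite expM // -oe expg_order mulg1.
have := cvM m Mm; rewrite Dv => cvm.
have := commuteM (commuteV (commute_refl m)) (commute_sym cvm).
by rewrite mulKg.
Qed.

(** The norm kernel has index [2] in the [r]-group [M], so [r = 2] and the kernel is ['C_M[e]]. It
    meets ['C_M[e ^ h]] trivially because [[~ e, h]] acts freely on [M]; hence [#|'C_M[e]| ^ 2 <=
    #|M| = 2 * #|'C_M[e]|]. *)
Lemma norm_kernel_Klein (M : {group coset_of Z}) e m h :
    M <| G / Z -> r.-abelem M -> e \in G / Z -> #[e] = r -> m \in M ->
    (m * e) ^+ r != 1 -> h \in G / Z -> [~ e, h] != 1 -> r^'.-elt [~ e, h] ->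
  [/\ r = 2, #|M| = 4, #|'C_M[e]| = 2 & m \notin 'C_M[e]].
Proof.
move=> nsMX abelM Xe oe Mm ntN Xh ntc r'c.
have leM := norm_kernel_card nsMX abelM Xe oe Mm ntN.
have [rM abM _] := and3P abelM; have [_ expM] := abelemP pr_r abelM.
have nMX := subsetP (normal_norm nsMX); have sMX := subsetP (normal_sub nsMX).
have er1 : e ^+ r = 1 by rewrite -oe expg_order.
set L := [set k in M | _] in leM.
have Lgroup : group_set L.
  apply/group_setP; rewrite !inE group1 mul1g er1 eqxx; split=> // k1 k2.
  rewrite !inE => /andP[Mk1 /eqP N1] /andP[Mk2 /eqP N2].
  by rewrite groupM //= (norm_mul abM (nMX e Xe) er1) // N1 N2 mulg1.
have sLM : Group Lgroup \subset M by apply/subsetP=> k; rewrite inE => /andP[].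
have nLm : m \notin L by rewrite inE Mm.
have iL : #|M : Group Lgroup| = 2.
  apply/eqP; rewrite eqn_leq indexg_gt1 andbC; apply/andP; split.
    by apply: contra nLm => /subsetP; apply.
  rewrite -(leq_pmul2l (cardG_gt0 (Group Lgroup))) Lagrange //.
  by rewrite mulnC.
have r2 : r = 2.
  have : r.-nat 2 by rewrite -iL; apply: pnat_dvd rM; apply: dvdn_indexg.
  by rewrite pnatE // => /eqnP.
have oM : #|M| = (#|L| * 2)%N by rewrite -iL -(Lagrange sLM).
have eV : e^-1 = e by apply: (mulgI e); rewrite mulgV -[e * e]/(e ^+ 2) -r2.
have DL : L = 'C_M[e].
  apply/setP=> k; rewrite inE in_setI; have [Mk /=|//] := boolP (k \in M).
  have kV : k^-1 = k.
    by apply: (mulgI k); rewrite mulgV -[k * k]/(k ^+ 2) -r2 expM.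
  have -> : (k * e) ^+ r = k * k ^ e.
    by rewrite r2 expgS expg1 conjgE eV !mulgA.
  rewrite -{1}kV -eq_mulVg1; apply/eqP/cent1P => [Dk | cke].
    by apply/commgP/conjg_fixP.
  by apply/esym/conjg_fixP/commgP.
rewrite DL in oM.
have trivI : 'C_M[e] :&: 'C_M[e ^ h] = 1.
  apply/trivgP/subsetP=> k /setIP[/setIP[Mk /cent1P cke] /setIP[_ /cent1P ckeh]].
  rewrite inE; apply: contraT => ntk.
  case: (normal_rgroup_regular nsMX abM rM Mk ntk _ ntc r'c); first exact: groupR.
  by rewrite commgEl; apply: commuteM => //; apply: commuteV.
have oCh : #|'C_M[e ^ h]| = #|'C_M[e]|.
  by rewrite cent1J -{1}(normP (nMX h Xh)) -conjIg cardJg.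
have leC : #|'C_M[e]| <= 2.
  have := mul_cardG 'C_M[e] 'C_M[e ^ h]; rewrite trivI cards1 muln1 oCh => oCC.
  rewrite -(leq_pmul2l (cardG_gt0 'C_M[e])) oCC -oM.
  by rewrite subset_leq_card // mul_subG ?subsetIl.
have Cw := norm_cent1 abM (nMX e Xe) er1 Mm.
have oC : #|'C_M[e]| = 2.
  apply/eqP; rewrite eqn_leq leC cardG_gt1; apply/trivgPn.
  by exists ((m * e) ^+ r).
by rewrite oM oC -DL.
Qed.

(* Otherwise [r = 2] and every abelian normal elementary subgroup [M] has order [4].
   [Mh] has centraliser [Z], so [K0 = 'C_(G / Z)(M)] embeds into ['Hom(Mh / Z, Z)],
   is elementary abelian, and equals [M].  Then [U] has order at most [2] because it
   acts freely on [M :\: 'C_M[e]], while the equinumerous ['C_G[v] / Z] contains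
   the element [m * e] of order [4]. *)
Lemma Sylow_normal : R / Z <| G / Z.
Proof.
apply/idPn=> nnR; have [M [nsMX abelM ntM]] := exists_normal_rabelem.
have [e [h [m [Xe oe Mm] [ntN Xh ntc r'c]]]] := Sylow_nonnormal_norm nnR nsMX abelM ntM.
have [r2 oM oC nCm] := norm_kernel_Klein nsMX abelM Xe oe Mm ntN Xh ntc r'c.
have [rM abM _] := and3P abelM; have [_ expM] := abelemP pr_r abelM.
have nMX := subsetP (normal_norm nsMX); have sMX := subsetP (normal_sub nsMX).
have [eh nZe Geh De] := morphimP Xe; rewrite /= in De.
have [mh nZm Gmh Dm] := morphimP (sMX m Mm); rewrite /= in Dm.
set v := mh * eh; have Gv : v \in G by apply: groupM.
have Dv : coset Z v = m * e by rewrite Dm De morphM ?(subsetP nZG).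
have gv k : k \in G -> k \in 'N(Z) := subsetP nZG k.
have er1 : e ^+ r = 1 by rewrite -oe expg_order.
set w := (m * e) ^+ r in ntN.
have Cw : w \in 'C_M[e] := norm_cent1 abM (nMX e Xe) er1 Mm.
have Mw : w \in M by case/setIP: Cw.
have Gvr : v ^+ r \in G by apply: groupX.
have Dvr : w = coset Z (v ^+ r) by rewrite morphX ?gv //= Dv.
have [_ Cvr] := commute_norm_lift nsMX abelM Mm Cw Geh Gmh Gvr De Dm Dvr ntN.
rewrite -/v in Cvr.
have ncv : nc v.
  by rewrite nc_coset // Dv; apply: contraNneq ntN; rewrite /w => ->; rewrite expg1n.
pose Mh := (coset Z @*^-1 M)%G; have MhZ : Mh / Z = M by apply: cosetpreK.
have nsMhG : Mh <| G by rewrite -(quotientGK (center_normal G)) cosetpre_normal.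
have Mh_of k : k \in G -> coset Z k \in M -> k \in Mh.
  by move=> Gk Mk; rewrite inE gv // inE.
have [hh nZh Ghh Dh] := morphimP Xh; rewrite /= in Dh.
(* A noncentral [c] centralising [Mh] has all its conjugates in ['C_G[v ^+ r] = 'C_G[v]], so
   ['C_G[c]] contains all conjugates of [v] and thus [[~ v, hh]], whose [r']-part is noncentral. It
   also contains an [r]-element lifting [w], against both cases of [cent1_dichotomy]. *)
have CZ : 'C_G(Mh) \subset Z.
  apply/subsetP=> c /setIP[Gc cMc]; apply/idPn=> nZc.
  have ncc : nc c by rewrite in_setD nZc.
  have vC g : g \in G -> v ^ g \in 'C_G[c].
    move=> Gg; have Ccg : c ^ g^-1 \in 'C_G(Mh).
      have nCG : G \subset 'N('C_G(Mh)) by rewrite normsI ?normG ?norms_cent ?normal_norm.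
      by rewrite memJ_norm ?groupV ?(subsetP nCG) // inE Gc.
    have [Gcg ccg] := setIP Ccg.
    have cgv : c ^ g^-1 \in 'C_G[v].
      rewrite Cvr inE Gcg; apply/cent1P; apply: (centP ccg).
      by apply: Mh_of => //; rewrite -Dvr.
    have : v \in 'C_G[c ^ g^-1] by apply: cent1_sym.
    by rewrite cent1_subgJ ?groupV // mem_conjgV.
  have Cz : [~ v, hh] \in 'C_G[c].
    by rewrite commgEl groupM ?vC // groupV -[v]conjg1 vC.
  have Gz : [~ v, hh] \in G by apply: groupR.
  have Dz : coset Z [~ v, hh] = [~ m * e, h] by rewrite morphR ?gv //= Dv Dh.
  have nrz : ~~ r.-elt [~ m * e, h].
    apply: contra ntc => rz; have [nMe nMh] := (nMX e Xe, nMX h Xh).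
    have nMm : m \in 'N(M) := nMX m (sMX m Mm).
    have DMz : coset M [~ m * e, h] = coset M [~ e, h].
      by rewrite !morphR ?groupM //= morphM //= (coset_id Mm) mul1g.
    have rc : coset M [~ e, h] = 1.
      apply/eqP; rewrite -order_eq1; apply/eqP; apply: (@pnat_1 r).
        by rewrite -DMz; apply: (morph_p_elt (coset_morphism M)); rewrite ?groupR ?groupM.
      by apply: (morph_p_elt (coset_morphism M)); rewrite ?groupR.
    have Mc : [~ e, h] \in M by apply: coset_idr; rewrite ?groupR.
    by rewrite -order_eq1 (pnat_1 (mem_p_elt rM Mc) r'c).
  pose z' := [~ v, hh].`_r^'; have Cz' : z' \in 'C_G[c] by apply: groupX.
  have Gz' : z' \in G by apply: groupX.
  have r'z' : r^'.-elt z' by apply: p_elt_constt.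
  have ntz' : coset Z z' != 1.
    rewrite [coset Z z'](morph_constt (coset_morphism Z)) ?gv //= Dz.
    apply: contra nrz => /eqP/constt1P; by rewrite p_eltNK.
  have [k [Mhk rk] [nZk Dk]] : exists2 k, k \in Mh /\ r.-elt k & k \in 'N(Z) /\ w = coset Z k.
    by apply: quotient_lift_elt; rewrite ?MhZ ?(mem_p_elt rM).
  have Gk : k \in G := subsetP (normal_sub nsMhG) k Mhk.
  have Ck : k \in 'C_G[c] by rewrite inE Gk; apply/cent1P/commute_sym; apply: (centP cMc).
  have rkb : r.-elt (coset Z k) by apply: (morph_p_elt (coset_morphism Z)).
  have r'zb : r^'.-elt (coset Z z') by apply: (morph_p_elt (coset_morphism Z)); rewrite ?gv.
  have ntk : coset Z k != 1 by rewrite -Dk.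
  have [abC | [p pr_p pC]] := cent1_dichotomy anti ncc.
    apply: (@r_r'_elts_not_commute (coset Z k) (coset Z z')); rewrite ?mem_quotient //.
    by rewrite /commute -!morphM ?gv //= (centsP abC k Ck z' Cz').
  have pk : p.-elt (coset Z k) by apply: mem_p_elt pC _; apply: mem_quotient.
  have pz : p.-elt (coset Z z') by apply: mem_p_elt pC _; apply: mem_quotient.
  have Dp : p = r := pelt_uniq ntk pk rkb.
  by case/negP: ntz'; rewrite -order_eq1 (pnat_1 _ r'zb) // -Dp.
pose K0 := 'C_(G / Z)(M)%G; have sMK0 : M \subset K0 by rewrite subsetI normal_sub.
have nsK0 : K0 <| G / Z by rewrite /normal subsetIl normsI ?normG ?norms_cent ?normal_norm.
have Zconj k g : k \in Mh -> g \in G -> coset Z g \in K0 -> exists2 c, c \in Z & k ^ g = k * c.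
  move=> Mhk Gg /setIP[_ cMg]; exists [~ k, g]; last by rewrite conjg_mulR.
  have Gk := subsetP (normal_sub nsMhG) k Mhk.
  apply: coset_idr; rewrite ?groupR ?gv // morphR ?gv //=; apply/eqP/commgP/commute_sym.
  by apply: (centP cMg); rewrite -MhZ mem_quotient.
have ZJ c g : c \in Z -> g \in G -> c ^ g = c.
  by move=> /setIP[_ /centP cGc] Gg; apply/conjg_fixP/commgP; apply: cGc.
have abelK0 : r.-abelem K0.
  apply/(abelemP pr_r); split.
    apply/centsP=> g1b K1 g2b K2.
    have [[Xg1 _] [Xg2 _]] := (setIP K1, setIP K2).
    have [g1 nZ1 Gg1 D1] := morphimP Xg1; have [g2 nZ2 Gg2 D2] := morphimP Xg2.
    rewrite /= in D1 D2; apply/commgP; rewrite D1 D2 -morphR //=.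
    apply/eqP/coset_id/(subsetP CZ); rewrite inE groupR //; apply/centP=> k Mhk.
    have gg k1 : k1 \in Mh -> k1 ^ (g1 * g2) = k1 ^ (g2 * g1).
      move=> Mhk1; have [|c1 Zc1 E1] := Zconj k1 g1 Mhk1 Gg1; first by rewrite -D1.
      have [|c2 Zc2 E2] := Zconj k1 g2 Mhk1 Gg2; first by rewrite -D2.
      rewrite !conjgM E1 E2 !conjMg E1 E2 (ZJ c1) ?(ZJ c2) // -!mulgA.
      by congr (_ * _); case/setIP: Zc1 => Gc1 _; case/setIP: Zc2 => _ /centP; apply.
    have -> : [~ g1, g2] = (g2 * g1)^-1 * (g1 * g2).
      by rewrite commgEl conjgE invMg !mulgA.
    apply/commute_sym/commgP/conjg_fixP; rewrite conjgM gg.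
      by rewrite -conjgM mulVg conjg1.
    by rewrite memJ_norm // groupV (subsetP (normal_norm nsMhG)) ?groupM.
  move=> gb K0g; have Xg := subsetP (subsetIl _ _) _ K0g.
  have [g nZg Gg Dg] := morphimP Xg; rewrite /= in Dg.
  rewrite Dg -morphX //=; apply/coset_id/(subsetP CZ).
  rewrite inE groupX //; apply/centP=> k Mhk; apply/commute_sym/commgP/conjg_fixP.
  have Gk := subsetP (normal_sub nsMhG) k Mhk.
  have [|c Zc Ec] := Zconj k g Mhk Gg; first by rewrite -Dg.
  have kgi i : k ^ (g ^+ i) = k * c ^+ i.
    elim: i => [|i IHi]; first by rewrite conjg1 mulg1.
    by rewrite expgSr conjgM IHi conjMg (ZJ (c ^+ i)) ?groupX // Ec -mulgA -expgS.
  have Zkr : k ^+ r \in Z.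
    apply: coset_idr; rewrite ?groupX ?gv // morphX ?gv //=.
    by rewrite expM // -MhZ mem_quotient.
  have cr1 : c ^+ r = 1.
    apply: (mulgI (k ^+ r)); rewrite -expgMn.
      by rewrite -Ec -conjXg ZJ // mulg1.
    by apply/commute_sym; case/setIP: Zc => _ /centP; apply.
  by rewrite kgi cr1 mulg1.
(* [norm_kernel_Klein] applies to [K0] as well as to [M], so both have order [4]. *)
have DM : M :=: K0.
  have ntK0 : K0 :!=: 1.
    by apply: contra ntM; rewrite -!subG1; apply: subset_trans.
  have [e1 [h1 [m1 [Xe1 oe1 Km1] [ntN1 Xh1 ntc1 r'c1]]]] :=
    Sylow_nonnormal_norm nnR nsK0 abelK0 ntK0.
  have [_ oK0 _ _] := norm_kernel_Klein nsK0 abelK0 Xe1 oe1 Km1 ntN1 Xh1 ntc1 r'c1.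
  by apply/eqP; rewrite eqEcard sMK0 oM oK0.
have nte : e != 1 by rewrite -order_gt1 oe prime_gt1.
have nce : nc eh by rewrite nc_coset // -De.
have rCe : r.-group ('C_G[eh] / Z).
  by apply: relt_cent1_rgroup => //; rewrite -De /p_elt oe pnat_id.
have rCv : r.-group ('C_G[v] / Z).
  apply: relt_cent1_rgroup => //; rewrite Dv.
  have : r.-nat (r * r)%N by rewrite pnatM pnat_id.
  by apply: pnat_dvd; rewrite order_dvdn expgM -/w expM.
have oCev : #|'C_G[eh] / Z| = #|'C_G[v] / Z|.
  by apply: card_cent1_quo_eq => //; apply: (cent1_pgroup_card_eq anti nce ncv rCe rCv).
pose U := ('C_G[eh] / Z)%G.
have UC u : u \in U -> u \in 'C_(G / Z)[e].
  case/morphimP=> uh nZu /setIP[Gu /cent1P cue] ->; rewrite inE mem_quotient //=.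
  by apply/cent1P; rewrite De /commute -!morphM //= cue.
have C2 k : k \in 'C_M[e] -> k != 1 -> k = w.
  move=> Ck ntk; apply/eqP; apply: contraT => neq_kw.
  have : [set 1; k; w] \subset 'C_M[e] by rewrite !subUset !sub1set group1 Ck.
  move/subset_leq_card; rewrite oC setUC cardsU1 cards2 !inE negb_or.
  by rewrite ntN [w == k]eq_sym neq_kw [1 == k]eq_sym ntk.
(* A nontrivial element of [U :&: M] would be [w], so [v ^+ r] would commute with [eh] and [v],
   hence with [mh]; then [mh] centralises [v], and [m] commutes with [e]. *)
have UM : U :&: M = 1.
  apply/trivgP/subsetP=> u /setIP[Uu Mu]; rewrite inE; apply: contraT => ntu.
  have Duw : u = w.
    apply: C2 => //; rewrite inE Mu.
    by case/setIP: (UC u Uu).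
  have [uh nZu /setIP[Gu /cent1P cue] Du] := morphimP Uu; rewrite /= in Du.
  have [|c Zc Dc] := coset_center_inj Gvr Gu; first by rewrite -Dvr -Duw.
  have cve : commute (v ^+ r) eh.
    rewrite Dc; apply/commute_sym; apply: commuteM; last exact/commute_sym.
    by apply/commute_sym; case/setIP: Zc => _ /centP; apply.
  have cvm : commute (v ^+ r) mh.
    have cvv : commute (v ^+ r) v by apply/commute_sym/commuteX.
    by have := commuteM cvv (commuteV cve); rewrite mulgK.
  have : mh \in 'C_G[v] by rewrite Cvr inE Gmh; apply/cent1P/commute_sym.
  case/setIP=> _ /cent1P cmv; case/negP: nCm; rewrite inE Mm; apply/cent1P.
  have cmb : commute m (m * e) by rewrite -Dv Dm /commute -!morphM ?gv //= cmv.
  by have := commuteM (commuteV (commute_refl m)) cmb; rewrite mulKg.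
have sUX : U \subset G / Z by rewrite quotientS ?subsetIl.
(* [U] centralises ['C_M[e]], of order [2]; an element of [U] that also fixes [m] centralises all of
   [M], so it lies in [U :&: K0 = U :&: M]. *)
have CUm : 'C_U[m] = 1.
  apply/trivgP; rewrite -UM DM subsetI subsetIl /= subsetI.
  rewrite (subset_trans (subsetIl _ _)) //=.
  apply/subsetP=> u /setIP[Uu /cent1P cum]; rewrite -sub_cent1.
  have sCCu : 'C_M[e] \subset 'C_M[u].
    apply/subsetP=> k Ck; have [Mk _] := setIP Ck; rewrite inE Mk; apply/cent1P.
    have [->|ntk] := eqVneq k 1; first exact/commute_sym/commute1.
    have Xu := subsetP sUX u Uu; have [_ /cent1P cue] := setIP (UC u Uu).
    apply/commgP/conjg_fixP; rewrite [RHS](C2 k Ck ntk); apply: C2; last by rewrite conjg_eq1.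
    rewrite inE memJ_norm ?nMX // Mk; apply/cent1P.
    have <- : e ^ u = e by apply/conjg_fixP/commgP/commute_sym.
    by rewrite /commute -!conjMg; case/setIP: Ck => _ /cent1P->.
  have ltC : 2 < #|'C_M[u]|.
    rewrite -oC; apply: proper_card; rewrite properE sCCu /=.
    apply: contra nCm => /subsetP; apply; rewrite inE Mm; apply/cent1P.
    exact: commute_sym.
  have : #|'C_M[u]| %| 4 by rewrite -oM cardSg ?subsetIl.
  have leC : #|'C_M[u]| <= 4 by rewrite -oM subset_leq_card ?subsetIl.
  move=> dvC; have oC4 : #|'C_M[u]| = 4.
    by case: #|_| ltC leC dvC => [|[|[|[|[|]]]]].
  have : 'C_M[u] = M by apply/eqP; rewrite eqEcard subsetIl oC4 oM.
  by move/setIidPl.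
have oU : #|U| <= 2.
  have <- : #|m ^: U| = #|U| by rewrite -index_cent1 CUm indexg1.
  have : m ^: U \subset M :\: 'C_M[e].
    apply/subsetP=> _ /imsetP[u Uu ->]; have Xu := subsetP sUX u Uu.
    rewrite in_setD (memJ_norm m (nMX u Xu)) Mm andbT; apply: contra nCm.
    have [_ /cent1P cue] := setIP (UC u Uu).
    case/setIP=> _ /cent1P cmu; rewrite inE Mm; apply/cent1P.
    have eu : e ^ u = e by apply/conjg_fixP/commgP/commute_sym.
    by apply: (conjg_inj u); rewrite !conjMg eu.
  move/subset_leq_card; rewrite cardsD (setIidPr _) ?subsetIl // oM oC.
  by [].
case/negP: ntN; rewrite /w r2 -Dv.
have vU : coset Z v \in 'C_G[v] / Z by rewrite mem_quotient ?cent1_id.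
have : #[coset Z v] %| 2.
  apply: dvdn_trans (order_dvdG vU) _; rewrite -oCev -[_ / _]/(gval U).
  by move: oU (cardG_gt0 U); case: #|U| => [|[|[|]]].
by rewrite order_dvdn.
Qed.

Lemma wild_Frobenius : [Frobenius (G / Z)].
Proof.
have nsPX := Sylow_normal; set X := (G / Z)%G in nsPX *.
have sylP : r.-Sylow(X) (R / Z)%G.
  by apply: quotient_pHall sylR; apply: subset_trans nZG; apply: pHall_sub sylR.
have /splitsP[H /complP[tiPH defX]] := SchurZassenhaus_split (pHall_Hall sylP) nsPX.
have sHX : H \subset X by rewrite -defX mulG_subr.
have sdX : (R / Z) ><| H = X.
  by rewrite sdprodE //; apply: subset_trans sHX (normal_norm nsPX).
have rP := pHall_pgroup sylP; have sRG := pHall_sub sylR.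
have ntP : R / Z != 1.
  apply: contra nabR => /eqP/trivgP; rewrite (quotient_sub1 (subset_trans sRG nZG)) => sRZ.
  exact: abelianS sRZ (center_abelian G).
have ntH : H :!=: 1.
  apply: contra nrb => /eqP H1; rewrite H1 mulg1 in defX.
  by rewrite defX in rP; apply: pgroupS rP; rewrite quotientS ?subsetIl.
have r'H : r^'.-group H.
  have /pHallP[_ oP] := sylP; have := sdprod_card sdX.
  rewrite [#|R / Z|]oP -{2}(partnC r (cardG_gt0 X)) => /eqP.
  by rewrite eqn_pmul2l ?part_gt0 // => /eqP oH; rewrite /pgroup oH part_pnat.
apply: (FrobeniusW (K := (R / Z)%G) (H := H)); apply/(Frobenius_semiregularP sdX ntP ntH).
move=> y /setD1P[nty Hy]; apply/trivgP/subsetP=> x /setIP[Px /cent1P cyx].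
rewrite inE; apply: contraT => ntx.
case: (@r_r'_elts_not_commute x y _ ntx (mem_p_elt rP Px) _ nty (mem_p_elt r'H Hy)).
- exact: subsetP (normal_sub nsPX) x Px.
- exact: subsetP sHX y Hy.
exact: commute_sym.
Qed.

End WildFrobenius.

(** * From the conjugate graph to centralisers *)

Section ClassSizes.

Variables (gT : finGroupType) (G : {group gT}).

Lemma mem_class_sizes x : x \in G :\: 'Z(G) -> #|x ^: G| \in class_sizes G.
Proof.
move=> ncx; rewrite mem_filter mem_undup -index_cent1 indexg_eq1.
rewrite index_cent1 image_f ?mem_classes ?(nc_G ncx) // andbT.
move: ncx; rewrite in_setD => /andP[nZx Gx]; apply: contra nZx.
by rewrite subsetI subxx /= sub_cent1 => cGx; rewrite inE Gx.
Qed.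

Lemma class_sizesP n : n \in class_sizes G ->
  exists2 x, x \in G :\: 'Z(G) & #|x ^: G| = n.
Proof.
rewrite mem_filter mem_undup => /andP[neq_n1 /imageP[_ /imsetP[x Gx ->] Dn]].
exists x => //; rewrite in_setD Gx andbT; apply: contra neq_n1 => /centerP[_ cGx].
rewrite Dn -index_cent1 indexg_eq1 subsetI subxx /= sub_cent1.
by apply/centP=> y Gy; apply: cGx.
Qed.

Lemma card_cent1_class x : x \in G -> (#|'C_G[x]| * #|x ^: G|)%N = #|G|.
Proof. by move=> Gx; rewrite -index_cent1 Lagrange ?subsetIl. Qed.

Hypothesis card2 : #|conj_vertex G| = 2.

Lemma conj_vertex_pair (c m n : conj_vertex G) : m != n -> (c == m) || (c == n).
Proof.
move=> neq_mn; apply: contraT; rewrite negb_or => /andP[neq_cm neq_cn].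
have : #|[set n; c; m]| <= #|conj_vertex G| by apply: max_card.
rewrite card2 setUC cardsU1 cards2 !inE negb_or neq_mn [m == c]eq_sym neq_cm.
by rewrite [n == c]eq_sym neq_cn.
Qed.

Hypothesis edgelessG : edgeless (@conj_graph gT G).

(** With only two vertices nothing lies strictly between [m] and [n], so divisibility would already
    be an edge. *)
Lemma edgeless_antichain (m n : conj_vertex G) : val m %| val n -> m = n.
Proof.
move=> dv_mn; apply/eqP; apply: contraT => neq_mn.
case/negP: (edgelessG m n); rewrite /conj_graph neq_mn dv_mn /=.
apply/existsPn=> c; apply/negP=> /and4P[neq_cm neq_cn _ _].
by have := conj_vertex_pair c neq_mn; rewrite (negPf neq_cm) (negPf neq_cn).
Qed.

Lemma class_size_antichain : cent_antichain G.
Proof.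
move=> x y ncx ncy dvC; have [Gx Gy] := (nc_G ncx, nc_G ncy).
have dv_cl : #|y ^: G| %| #|x ^: G|.
  rewrite -(dvdn_pmul2l (cardG_gt0 'C_G[x])) card_cent1_class //.
  by rewrite -(card_cent1_class Gy) dvdn_mul.
have eq_cl := congr1 val (@edgeless_antichain (SeqSub (mem_class_sizes ncy))
  (SeqSub (mem_class_sizes ncx)) dv_cl).
apply/eqP; rewrite /= in eq_cl.
have cl_gt0 : 0 < #|x ^: G| by rewrite -index_cent1 indexg_gt0.
by rewrite -(eqn_pmul2r cl_gt0) card_cent1_class // -eq_cl card_cent1_class.
Qed.

Lemma two_cent1_cards : exists x y, [/\ x \in G :\: 'Z(G), y \in G :\: 'Z(G),
  #|'C_G[x]| != #|'C_G[y]| & forall w, w \in G :\: 'Z(G) ->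
    #|'C_G[w]| = #|'C_G[x]| \/ #|'C_G[w]| = #|'C_G[y]|].
Proof.
have /card_gt1P[m [n [_ _ neq_mn]]] : 1 < #|conj_vertex G| by rewrite card2.
have [x ncx Dm] := class_sizesP (valP m); have [y ncy Dn] := class_sizesP (valP n).
have eqC u v : u \in G -> v \in G -> (#|'C_G[u]| == #|'C_G[v]|) = (#|u ^: G| == #|v ^: G|).
  move=> Gu Gv; have gt0 : 0 < #|v ^: G| by rewrite -index_cent1 indexg_gt0.
  rewrite -(eqn_pmul2r gt0) card_cent1_class // -(card_cent1_class Gu).
  by rewrite eqn_pmul2l ?cardG_gt0 // eq_sym.
have [Gx Gy] := (nc_G ncx, nc_G ncy); exists x, y; split=> //.
  by rewrite eqC // Dm Dn.
move=> w ncw; have Gw := nc_G ncw; pose c : conj_vertex G := SeqSub (mem_class_sizes ncw).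
apply/pred2P; rewrite /= !eqC // Dm Dn -[#|w ^: G|]/(val c) !(inj_eq val_inj).
exact: conj_vertex_pair.
Qed.

End ClassSizes.

Lemma two_cent1_cards_Frobenius (gT : finGroupType) (G : {group gT}) x y :
    cent_antichain G -> x \in G :\: 'Z(G) -> y \in G :\: 'Z(G) ->
    #|'C_G[x]| != #|'C_G[y]| ->
    (forall w, w \in G :\: 'Z(G) ->
       #|'C_G[w]| = #|'C_G[x]| \/ #|'C_G[w]| = #|'C_G[y]|) ->
  solvable (G / 'Z(G)) /\ [Frobenius (G / 'Z(G))].
Proof.
move=> anti; wlog wildx : x y / ~~ tame G x.
  move=> IH ncx ncy neqC sizes; have [tamex|] := boolP (tame G x); last first.
    by move=> wildx; apply: IH wildx ncx ncy neqC sizes.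
  have [tamey|wildy] := boolP (tame G y); first exact: tame_Frobenius neqC sizes _ _.
  apply: IH wildy ncy ncx _ _; first by rewrite eq_sym.
  by move=> w /sizes[]; [right | left].
move=> ncx ncy neqC sizes.
have [r [R [pr_r sylR] [nabR rCx]]] := wild_component anti ncx wildx.
have nry : ~~ r.-group ('C_G[y] / 'Z(G)).
  by apply: contra neqC => rCy; apply/eqP; apply: cent1_pgroup_card_eq rCx rCy.
have sizes_r w : w \in G :\: 'Z(G) ->
    r.-group ('C_G[w] / 'Z(G)) \/ #|'C_G[w]| = #|'C_G[y]|.
  move=> ncw; case: (sizes w ncw) => [eqC|]; [left | by right].
  by rewrite /pgroup (card_cent1_quo_eq (nc_G ncw) (nc_G ncx) eqC).
have solX : solvable (G / 'Z(G)).
  have [tamey|wildy] := boolP (tame G y).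
    exact: wild_tame_solvable sylR nabR ncy nry sizes_r tamey.
  have [q [_ _ [_ qCy]]] := wild_component anti ncy wildy.
  exact: (wild_wild_solvable ncy sizes_r qCy).
split=> //; exact: wild_Frobenius sylR nabR ncx rCx ncy nry sizes_r solX.
Qed.

Theorem corollary1 (gT : finGroupType) (G : {group gT})
    (hedge : edgeless (@conj_graph gT G))
    (hcard : #|conj_vertex G| = 2) :
  solvable (G / 'Z(G))%g /\ [Frobenius (G / 'Z(G))%g]%g.
Proof.
have [x [y [ncx ncy neqC sizes]]] := two_cent1_cards hcard.
exact: two_cent1_cards_Frobenius (class_size_antichain hcard hedge) ncx ncy neqC sizes.
Qed.
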